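(* Let $X$ and $Y$ be the first-hop and second-hop SNRs of the selected relay (independent, with the distributions given in the context), let $\zeta\ge 1$ be a constant, let $c=\mathbb{E}[X]+\zeta$, and let $\gamma=\frac{XY}{\zeta Y+\mathbb{E}[X]+\zeta}$ be the fixed-gain end-to-end SNDR. Then the ergodic capacity $\overline{C}=\frac12\mathbb{E}[\log_2(1+\gamma)]$ equals $$\overline{C}=\frac{k^2\binom{N}{k}^2}{2\log(2)\,\bar\gamma_1}\sum_{m=0}^{k-1}\sum_{n=0}^{k-1}\sum_{i=1}^{2}\sum_{j=1}^{2}S_mP_nT_{m,i}Q_{n,j}\sqrt{\frac{U_{m,i}c}{R_{n,j}}}\;\mathcal{G}\!\left(\frac{R_{n,j}\zeta}{\bar\gamma_1},\frac{U_{m,i}R_{n,j}c}{\bar\gamma_1^2}\right),$$ where $\log$ is the natural logarithm and $\mathcal{G}(x,y)=G_{1,1:0,1:0,2}^{1,1:1,0:2,0}\left(\begin{smallmatrix}-1/2\\-1/2\end{smallmatrix}\Big|\begin{smallmatrix}-\\0\end{smallmatrix}\Big|\begin{smallmatrix}-\\ 1/2,\,-1/2\end{smallmatrix}\Big|x,y\right)$ is the bivariate Meijer G-function defined in the context.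
   Context: Integers $1\le k\le N$ ($N$ relays, the relay of rank $k$ is selected), average SNRs $\bar\gamma_1,\bar\gamma_2>0$, correlation coefficients $\rho_1,\rho_2\in[0,1]$, and $\bar\gamma=\bar\gamma_1\bar\gamma_2/(\bar\gamma_1+\bar\gamma_2)$. For $0\le n,m\le k-1$ set $$P_n=\frac{(-1)^n\binom{k-1}{n}}{1+\frac{\bar\gamma_2}{\bar\gamma}(N-k+n)},\qquad S_m=\frac{(-1)^m\binom{k-1}{m}}{1+\frac{\bar\gamma_1}{\bar\gamma}(N-k+m)},$$ $$Q_{n,1}=1,\quad Q_{n,2}=\frac{(N-k+n)\bar\gamma_2}{\rho_1\bar\gamma+(1-\rho_1)(N-k+n+1)\bar\gamma_1},\qquad R_{n,1}=1,\quad R_{n,2}=\frac{(N-k+n+1)\bar\gamma_1}{\rho_1\bar\gamma+(1-\rho_1)(N-k+n+1)\bar\gamma_1},$$ $$T_{m,1}=1,\quad T_{m,2}=\frac{(N-k+m)\bar\gamma_1}{(N-k+m+1)\bar\gamma_2},\qquad U_{m,1}=\frac{\bar\gamma_1}{\bar\gamma_2},\quad U_{m,2}=\frac{(N-k+m+1)\bar\gamma_1}{\rho_2\bar\gamma+(1-\rho_2)(N-k+m+1)\bar\gamma_2}.$$ $X$ and $Y$ are independent nonnegative random variables; $X$ has density, for $x\ge 0$, $$f_X(x)=\frac{k}{\bar\gamma_1}\binom{N}{k}\sum_{n=0}^{k-1}\sum_{j=1}^{2}P_nQ_{n,j}\exp\!\left(-\frac{R_{n,j}x}{\bar\gamma_1}\right),$$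 and $Y$ has CDF, for $x\ge 0$, $$F_Y(x)=1-k\binom{N}{k}\sum_{m=0}^{k-1}\sum_{i=1}^{2}S_mT_{m,i}\exp\!\left(-\frac{U_{m,i}x}{\bar\gamma_1}\right).$$ The bivariate Meijer G-function with these parameters is the double Mellin–Barnes integral, for $x,y>0$, $$\mathcal{G}(x,y)=\frac{1}{(2\pi \mathrm{i})^2}\int_{\mathcal{L}_1}\int_{\mathcal{L}_2}\Gamma\!\left(\tfrac32+s+t\right)\Gamma\!\left(-\tfrac12-s-t\right)\Gamma(-s)\,\Gamma\!\left(\tfrac12-t\right)\Gamma\!\left(-\tfrac12-t\right)x^{s}y^{t}\,dt\,ds,$$ where $\mathcal L_1,\mathcal L_2$ are upward vertical lines with $\operatorname{Re}s<0$, $\operatorname{Re}t<-\tfrac12$ and $-\tfrac32<\operatorname{Re}(s+t)<-\tfrac12$ (for example $\operatorname{Re}s=-\tfrac14$, $\operatorname{Re}t=-\tfrac34$). *)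

(* Defs.v *)
From HB Require Import structures.
From mathcomp Require Import all_boot all_order all_algebra.
From mathcomp Require Import all_classical all_reals all_analysis.
From mathcomp Require Import complex.

Set Implicit Arguments.
Unset Strict Implicit.
Unset Printing Implicit Defensive.
Import Order.TTheory GRing.Theory Num.Theory.
Import numFieldNormedType.Exports.

Local Open Scope classical_set_scope.
Local Open Scope ring_scope.
Local Open Scope complex_scope.

(* P(X \in A, Y \in B) = P(X \in A) P(Y \in B) for all Borel A and B. *)
Definition independent_RVs d (T : measurableType d) (R : realType)
    (P : probability T R) (X Y : {RV P >-> R}) : Prop :=
  forall A B : set R, measurable A -> measurable B ->
    P ((X @^-1` A) `&` (Y @^-1` B)) = (P (X @^-1` A) * P (Y @^-1` B))%E.

Definition has_density d (T : measurableType d) (R : realType)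
    (P : probability T R) (X : {RV P >-> R}) (f : R -> R) : Prop :=
  forall A : set R, measurable A ->
    distribution P X A = (\int[lebesgue_measure]_(x in A) (f x)%:E)%E.

(* [g1] and [g2] are the average SNRs of the two hops; the third average SNR
   of the model is derived from them. *)
Definition snr_bar (R : realType) (g1 g2 : R) : R := g1 * g2 / (g1 + g2).

(* Since 1 <= k <= N is assumed wherever these are used, the truncated
   subtractions [N - k] and [k - 1] on nat are genuine ones. *)
Definition coefP (R : realType) (N k : nat) (g1 g2 : R) (n : nat) : R :=
  (-1) ^+ n * 'C(k - 1, n)%:R
  / (1 + g2 / snr_bar g1 g2 * (N - k + n)%:R).

Definition coefS (R : realType) (N k : nat) (g1 g2 : R) (m : nat) : R :=
  (-1) ^+ m * 'C(k - 1, m)%:R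
  / (1 + g1 / snr_bar g1 g2 * (N - k + m)%:R).

(* In the four families below the second index ranges over {1, 2}. *)
Definition coefQ (R : realType) (N k : nat) (g1 g2 rho1 : R) (n j : nat) : R :=
  if j == 1%N then 1 else
  (N - k + n)%:R * g2
  / (rho1 * snr_bar g1 g2 + (1 - rho1) * (N - k + n + 1)%:R * g1).

Definition coefR (R : realType) (N k : nat) (g1 g2 rho1 : R) (n j : nat) : R :=
  if j == 1%N then 1 else
  (N - k + n + 1)%:R * g1
  / (rho1 * snr_bar g1 g2 + (1 - rho1) * (N - k + n + 1)%:R * g1).

Definition coefT (R : realType) (N k : nat) (g1 g2 : R) (m i : nat) : R :=
  if i == 1%N then 1 else
  (N - k + m)%:R * g1 / ((N - k + m + 1)%:R * g2).

Definition coefU (R : realType) (N k : nat) (g1 g2 rho2 : R) (m i : nat) : R :=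
  if i == 1%N then g1 / g2 else
  (N - k + m + 1)%:R * g1
  / (rho2 * snr_bar g1 g2 + (1 - rho2) * (N - k + m + 1)%:R * g2).

Definition first_hop_pdf (R : realType) (N k : nat) (g1 g2 rho1 x : R) : R :=
  if 0 <= x then
    k%:R / g1 * 'C(N, k)%:R *
    \sum_(0 <= n < k) \sum_(1 <= j < 3)
      coefP N k g1 g2 n * coefQ N k g1 g2 rho1 n j
      * expR (- (coefR N k g1 g2 rho1 n j * x / g1))
  else 0.

(* Only meant for x >= 0. *)
Definition second_hop_cdf (R : realType) (N k : nat) (g1 g2 rho2 x : R) : R :=
  1 - k%:R * 'C(N, k)%:R *
    \sum_(0 <= m < k) \sum_(1 <= i < 3)
      coefS N k g1 g2 m * coefT N k g1 g2 m i
      * expR (- (coefU N k g1 g2 rho2 m i * x / g1)).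

(* [fine] only turns the (finite) mean E[X] into a real number. *)
Definition mean d (T : measurableType d) (R : realType)
    (P : probability T R) (X : {RV P >-> R}) : R := fine ('E_P[X])%E.

Definition fixed_gain_sndr d (T : measurableType d) (R : realType)
    (P : probability T R) (X Y : {RV P >-> R}) (zeta : R) (w : T) : R :=
  X w * Y w / (zeta * Y w + mean X + zeta).

Definition log2 (R : realType) (x : R) : R := ln x / ln 2.

Definition ergodic_capacity d (T : measurableType d) (R : realType)
    (P : probability T R) (X Y : {RV P >-> R}) (zeta : R) : \bar R :=
  ((2^-1)%:E * 'E_P[fun w => (log2 (1 + fixed_gain_sndr X Y zeta w))%R])%E.

(* Lebesgue integral of a complex-valued function of a real variable. *)
Definition Cintegral (R : realType) (D : set R) (f : R -> R[i]) : R[i] :=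
  (\int[lebesgue_measure]_(x in D) complex.Re (f x))
  +i* (\int[lebesgue_measure]_(x in D) complex.Im (f x)).

(* x ^ s = exp (s ln x), for real x > 0 and complex s. *)
Definition Cpow (R : realType) (x : R) (s : R[i]) : R[i] :=
  (expR (complex.Re s * ln x) * cos (complex.Im s * ln x))
  +i* (expR (complex.Re s * ln x) * sin (complex.Im s * ln x)).

(* Euler's integral, i.e. the Gamma function on the half-plane Re z > 0; all
   the arguments occurring in [meijerG2] lie in that half-plane for the
   admissible contours. *)
Definition Gamma (R : realType) (z : R[i]) : R[i] :=
  Cintegral `]0, +oo[ (fun t => Cpow t (z - 1) * (expR (- t))%:C).

(* The integral of f along the upward vertical line Re s = a, where ds = i du. *)
Definition vline_integral (R : realType) (a : R) (f : R[i] -> R[i]) : R[i] :=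
  (0 +i* 1) * Cintegral setT (fun u => f (a +i* u)).

Definition admissible_contours (R : realType) (a b : R) : Prop :=
  [/\ a < 0, b < - 2^-1, - (3 / 2) < a + b & a + b < - 2^-1].

(* The bivariate Meijer G-function
     G_{1,1:0,1:0,2}^{1,1:1,0:2,0}(-1/2; -1/2 | -; 0 | -; 1/2, -1/2 | x, y)
   for x, y > 0, as a double Mellin-Barnes integral along the lines
   L1 = {Re s = a} and L2 = {Re t = b}. *)
Definition meijerG2 (R : realType) (a b x y : R) : R[i] :=
  (2 * (pi : R)%:C * (0 +i* 1)) ^- 2 *
  vline_integral a (fun s => vline_integral b (fun t =>
    Gamma (3 / 2 + s + t) * Gamma (- 2^-1 - s - t)
    * Gamma (- s) * Gamma (2^-1 - t) * Gamma (- 2^-1 - t)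
    * Cpow x s * Cpow y t)).

(* Main.v *)
Require Import Defs.
From HB Require Import structures.
From mathcomp Require Import all_boot all_order all_algebra.
From mathcomp Require Import all_classical all_reals all_analysis.
From mathcomp Require Import measurable_realfun complex ring lra.

Set Implicit Arguments.
Unset Strict Implicit.
Unset Printing Implicit Defensive.
Import Order.TTheory GRing.Theory Num.Theory.
Import numFieldNormedType.Exports.

Local Open Scope classical_set_scope.
Local Open Scope ring_scope.
Local Open Scope complex_scope.

(* The capacity is computed twice as an integral over s = ln z. On the probability
   side, ln (1 + g) is the integral of e^s / (1 + e^s) over e^s < g, so E[ln (1 + g)]
   is the integral of e^s / (1 + e^s) P(g > e^s), and independence turns the tail
   P(g > z) into the integral over v > 0 of f_X(v + zeta z) P(Y > c z / v), a finite
   sum of exponential terms. On the Mellin-Barnes side every gamma function on a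
   vertical line is the Fourier transform of exp (p r - e^r); the product
   Gamma(3/2 + s + t) Gamma(-1/2 - s - t) is the transform of e^(p w) / (1 + e^w), and
   Fubini together with Fourier inversion (by Poisson summability; the functional
   equation of Gamma provides the integrability) collapses the double contour
   integral to the same real integral, term by term. *)

(** * Complex-valued integrals *)

(** The obstacle is the pair Gamma(3/2 + s + t) Gamma(-1/2 - s - t), which couples the two contours.
    Once it is the transform of an integrable kernel in w, its phase splits into [cis (u * w)] and
    [cis (v * w)], so Fubini only meets products of one-variable integrable factors with a bounded
    phase. What remains to be shown is that u |-> Gamma(p + iu) is integrable: two uses of the
    functional equation give decay of order u^-2, which replaces Stirling's formula. Poisson
    summability suits this setting because the transform of e^(-e|u|) is elementary. The two
    computations meet in the integral 2 sqrt(Y) K_1(2 sqrt(Y)), with K_1 the modified Bessel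
    function: it is the inverse transform of the two gamma factors in t up to a power, and also the
    integral over v of an exponential density against an exponential tail at c z / v. The abscissas
    a and b disappear only there, when the powers are collected. The integrability of the collapsed
    integrand is a by-product of Fubini, and it is what proves that the capacity is finite. *)

Section complex_numbers.
Context (R : realType).
Implicit Types z w : R[i].

Definition cis (x : R) : R[i] := cos x +i* sin x.

(** Real and imaginary parts are integrated separately, and this submultiplicative norm controls
    both without square roots; the price is the bound 2 instead of 1 for [cis]. *)
Definition l1norm z : R := `|complex.Re z| + `|complex.Im z|.

Lemma Re_mulc z w : complex.Re (z * w) =
  complex.Re z * complex.Re w - complex.Im z * complex.Im w.
Proof. by case: z w => [? ?] [? ?]. Qed.

Lemma Im_mulc z w : complex.Im (z * w) =
  complex.Re z * complex.Im w + complex.Im z * complex.Re w.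
Proof. by case: z w => [? ?] [? ?]. Qed.

Lemma complexP z w : complex.Re z = complex.Re w ->
  complex.Im z = complex.Im w -> z = w.
Proof. by case: z w => [? ?] [? ?] /= -> ->. Qed.

Lemma cisD (x y : R) : cis (x + y) = cis x * cis y.
Proof. by apply: complexP; rewrite ?Re_mulc ?Im_mulc/= ?cosD// sinD addrC. Qed.

Lemma cis0 : cis 0 = 1.
Proof. by apply: complexP; rewrite /= ?cos0 ?sin0. Qed.

Lemma l1norm_ge0 z : 0 <= l1norm z.
Proof. by rewrite addr_ge0. Qed.

Lemma normr_Re_le z : `|complex.Re z| <= l1norm z.
Proof. by rewrite lerDl. Qed.

Lemma normr_Im_le z : `|complex.Im z| <= l1norm z.
Proof. by rewrite lerDr. Qed.

Lemma l1normM z w : l1norm (z * w) <= l1norm z * l1norm w.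
Proof.
rewrite /l1norm Re_mulc Im_mulc.
have := ler_normB (complex.Re z * complex.Re w) (complex.Im z * complex.Im w).
have := ler_normD (complex.Re z * complex.Im w) (complex.Im z * complex.Re w).
rewrite !normrM; lra.
Qed.

Lemma l1norm_real (x : R) : l1norm x%:C = `|x|.
Proof. by rewrite /l1norm /= normr0 addr0. Qed.

Lemma l1norm_cis (x : R) : l1norm (cis x) <= 2.
Proof.
rewrite /l1norm /=; have := cos_max x; have := sin_max x; lra.
Qed.

Lemma l1normM_cis z x : l1norm (z * cis x) <= l1norm z * 2.
Proof.
by rewrite (le_trans (l1normM _ _))// ler_wpM2l ?l1norm_ge0 ?l1norm_cis.
Qed.

End complex_numbers.

Section complex_measurable.
Context d (T : measurableType d) (R : realType).
Implicit Types f g : T -> R[i].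

Definition Cmeasurable f :=
  measurable_fun setT (fun x => complex.Re (f x)) /\
  measurable_fun setT (fun x => complex.Im (f x)).

Lemma CmeasurableM f g : Cmeasurable f -> Cmeasurable g ->
  Cmeasurable (fun x => f x * g x).
Proof.
move=> [f1 f2] [g1 g2]; split.
  by under eq_fun do rewrite Re_mulc; apply: measurable_funB; apply: measurable_funM.
by under eq_fun do rewrite Im_mulc; apply: measurable_funD; apply: measurable_funM.
Qed.

Lemma Cmeasurable_real (f : T -> R) : measurable_fun setT f ->
  Cmeasurable (fun x => (f x)%:C).
Proof. by move=> mf; split => //=; exact: measurable_cst. Qed.

Lemma Cmeasurable_cst c : Cmeasurable (fun=> c).
Proof. by split; exact: measurable_cst. Qed.

Lemma Cmeasurable_cis (f : T -> R) : measurable_fun setT f ->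
  Cmeasurable (fun x => cis (f x)).
Proof.
move=> mf; split => /=; apply: measurableT_comp => //;
  apply: continuous_measurable_fun; [exact: continuous_cos|exact: continuous_sin].
Qed.

End complex_measurable.

Lemma Cmeasurable_comp d1 d2 (T1 : measurableType d1) (T2 : measurableType d2)
  (R : realType) (f : T2 -> R[i]) (g : T1 -> T2) :
  measurable_fun setT g -> Cmeasurable f -> Cmeasurable (fun x => f (g x)).
Proof.
move=> mg [f1 f2]; split.
  exact: (measurableT_comp f1 mg).
exact: (measurableT_comp f2 mg).
Qed.

Section complex_integral.
Context d (T : measurableType d) (R : realType) (mu : {measure set T -> \bar R}).
Implicit Types f g : T -> R[i].

(** For Lebesgue measure this is convertible to [Cintegral setT], so contour integrals can be
    replaced by [Cint] without rewriting. *)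
Definition Cint f : R[i] :=
  (\int[mu]_x complex.Re (f x)) +i* (\int[mu]_x complex.Im (f x)).

Definition Cintegrable f :=
  mu.-integrable setT (EFin \o (fun x => complex.Re (f x))) /\
  mu.-integrable setT (EFin \o (fun x => complex.Im (f x))).

Lemma Cintegrable_measurable f : Cintegrable f -> Cmeasurable f.
Proof.
by move=> [/integrableP[? _] /integrableP[? _]]; split; exact/measurable_EFinP.
Qed.

Lemma le_integrable_EFin (f g : T -> R) : measurable_fun setT f ->
  (forall x, `|f x| <= g x) -> mu.-integrable setT (EFin \o g) ->
  mu.-integrable setT (EFin \o f).
Proof.
move=> mf fg; apply: le_integrable => //; first exact/measurable_EFinP.
by move=> x _ /=; rewrite lee_fin (le_trans (fg x)) ?ler_norm.
Qed.

Lemma integrable_EFinZl (f : T -> R) (c : R) : mu.-integrable setT (EFin \o f) ->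
  mu.-integrable setT (EFin \o (fun x => c * f x)).
Proof. exact: (integrableZl measurableT c). Qed.

Lemma le_Cintegrable f (g : T -> R) : Cmeasurable f ->
  (forall x, l1norm (f x) <= g x) -> mu.-integrable setT (EFin \o g) ->
  Cintegrable f.
Proof.
move=> [mf1 mf2] fg ig; split; apply: le_integrable_EFin ig => // x.
  by rewrite (le_trans (normr_Re_le _)).
by rewrite (le_trans (normr_Im_le _)).
Qed.

Lemma Cintegrable_l1norm f : Cintegrable f ->
  mu.-integrable setT (EFin \o (fun x => l1norm (f x))).
Proof.
move=> [if1 if2].
have := @integrableD _ _ _ mu setT measurableT _ _ (integrable_norm if1)
  (integrable_norm if2).
by apply: eq_integrable.
Qed.

Lemma Cintegrable_real (f : T -> R) : mu.-integrable setT (EFin \o f) ->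
  Cintegrable (fun x => (f x)%:C).
Proof. by move=> if1; split => //=; exact: integrable0. Qed.

Lemma CintegrableZl f c : Cintegrable f -> Cintegrable (fun x => c * f x).
Proof.
move=> cf; apply: (@le_Cintegrable _ (fun x => l1norm c * l1norm (f x))).
- by apply: CmeasurableM; [exact: Cmeasurable_cst|exact: Cintegrable_measurable].
- by move=> x; exact: l1normM.
- exact: (integrableZl measurableT _ (Cintegrable_l1norm cf)).
Qed.

Lemma CintegrableM_bounded f g (M : R) : Cintegrable f -> Cmeasurable g ->
  (forall x, l1norm (g x) <= M) -> Cintegrable (fun x => f x * g x).
Proof.
move=> cf mg gM; apply: (@le_Cintegrable _ (fun x => M * l1norm (f x))).
- by apply: CmeasurableM => //; exact: Cintegrable_measurable.
- move=> x; rewrite (le_trans (l1normM _ _))// mulrC ler_wpM2r ?l1norm_ge0//.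
- exact: (integrableZl measurableT _ (Cintegrable_l1norm cf)).
Qed.

Lemma CintegrableM_cis f (h : T -> R) : Cintegrable f ->
  measurable_fun setT h -> Cintegrable (fun x => f x * cis (h x)).
Proof.
move=> cf mh; apply: CintegrableM_bounded cf _ _; first exact: Cmeasurable_cis.
by move=> x; exact: l1norm_cis.
Qed.

Lemma CintZl f c : Cintegrable f -> Cint (fun x => c * f x) = c * Cint f.
Proof.
move=> [if1 if2]; apply: complexP; rewrite ?Re_mulc ?Im_mulc /Cint/=.
- under eq_Rintegral do rewrite Re_mulc.
  by rewrite RintegralB ?RintegralZl//; exact: integrable_EFinZl.
- under eq_Rintegral do rewrite Im_mulc.
  by rewrite RintegralD ?RintegralZl//; exact: integrable_EFinZl.
Qed.

Lemma CintZr f c : Cintegrable f -> Cint (fun x => f x * c) = Cint f * c.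
Proof.
by move=> cf; rewrite mulrC -CintZl//; congr Cint; apply/funext => x; rewrite mulrC.
Qed.

Lemma Cint_real (f : T -> R) : Cint (fun x => (f x)%:C) = (\int[mu]_x f x)%:C.
Proof.
by apply: complexP => //=; rewrite /Rintegral integral0.
Qed.

Lemma eq_Cint f g : f =1 g -> Cint f = Cint g.
Proof. by move=> /funext ->. Qed.

Lemma l1norm_Cint_le f : Cintegrable f ->
  l1norm (Cint f) <= \int[mu]_x l1norm (f x).
Proof.
move=> [if1 if2]; rewrite /Cint /l1norm/= RintegralD//; last 2 first.
- exact: (integrable_norm if1).
- exact: (integrable_norm if2).
by apply: lerD; apply: le_normr_Rintegral.
Qed.

End complex_integral.

(** * Fubini for complex integrands *)

Section complex_fubini.
Context d1 d2 (T1 : measurableType d1) (T2 : measurableType d2) (R : realType).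
Variables (m1 : {sigma_finite_measure set T1 -> \bar R})
          (m2 : {sigma_finite_measure set T2 -> \bar R}).

Section real.
Variable f : T1 * T2 -> R.
Hypothesis f_int : (m1 \x m2)%E.-integrable setT (EFin \o f).
Hypothesis f_int1 : forall x, m2.-integrable setT (EFin \o (fun y => f (x, y))).
Hypothesis f_int2 : forall y, m1.-integrable setT (EFin \o (fun x => f (x, y))).

(** Sections are assumed integrable at every point, not just almost everywhere: the [fine] hidden in
    the real integral then loses nothing, and no exceptional set has to be carried along. *)
Lemma Rintegral_fubiniE :
  (EFin \o (fun x => \int[m2]_y f (x, y))) = fubini_F m2 (EFin \o f).
Proof.
apply/funext => x /=; rewrite /Rintegral fineK//.
exact: (integrable_fin_num _ (f_int1 x)).
Qed.

Lemma Rintegral_fubini_integrable :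
  m1.-integrable setT (EFin \o (fun x => \int[m2]_y f (x, y))).
Proof. by rewrite Rintegral_fubiniE; exact: integrable_fubini_F. Qed.

Lemma Rintegral_swap : \int[m1]_x (\int[m2]_y f (x, y)) =
                       \int[m2]_y (\int[m1]_x f (x, y)).
Proof.
rewrite {1}/Rintegral [in RHS]/Rintegral; congr fine.
transitivity (\int[m1]_x (fubini_F m2 (EFin \o f) x))%E.
  by rewrite -Rintegral_fubiniE.
rewrite /fubini_F (Fubini f_int); apply: eq_integral => y _ /=.
by rewrite /Rintegral fineK//; exact: (integrable_fin_num _ (f_int2 y)).
Qed.

End real.

Variable f : T1 * T2 -> R[i].
Hypothesis f_int : Cintegrable (m1 \x m2)%E f.
Hypothesis f_int1 : forall x, Cintegrable m2 (fun y => f (x, y)).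
Hypothesis f_int2 : forall y, Cintegrable m1 (fun x => f (x, y)).

Lemma Cint_fubini_integrable : Cintegrable m1 (fun x => Cint m2 (fun y => f (x, y))).
Proof.
split.
  apply: (@Rintegral_fubini_integrable (fun z => complex.Re (f z))).
  - exact: f_int.1.
  - by move=> x; exact: (f_int1 x).1.
apply: (@Rintegral_fubini_integrable (fun z => complex.Im (f z))).
- exact: f_int.2.
- by move=> x; exact: (f_int1 x).2.
Qed.

Lemma Cint_swap : Cint m1 (fun x => Cint m2 (fun y => f (x, y))) =
                  Cint m2 (fun y => Cint m1 (fun x => f (x, y))).
Proof.
apply: complexP => /=.
  apply: (@Rintegral_swap (fun z => complex.Re (f z))).
  - exact: f_int.1.
  - by move=> x; exact: (f_int1 x).1.
  - by move=> x; exact: (f_int2 x).1.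
apply: (@Rintegral_swap (fun z => complex.Im (f z))).
- exact: f_int.2.
- by move=> x; exact: (f_int1 x).2.
- by move=> x; exact: (f_int2 x).2.
Qed.

End complex_fubini.

Section product_integrable.
Context d1 d2 (T1 : measurableType d1) (T2 : measurableType d2) (R : realType).
Variables (m1 : {sigma_finite_measure set T1 -> \bar R})
          (m2 : {sigma_finite_measure set T2 -> \bar R}).

Lemma integrable_prodM (f : T1 -> R) (g : T2 -> R) :
  m1.-integrable setT (EFin \o f) -> m2.-integrable setT (EFin \o g) ->
  (m1 \x m2)%E.-integrable setT (EFin \o (fun z => f z.1 * g z.2)).
Proof.
move=> if1 ig; have /integrableP[mf foo] := if1; have /integrableP[mg goo] := ig.
move: mf mg => /measurable_EFinP mf /measurable_EFinP mg.
apply/integrable12ltyP.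
  apply/measurable_EFinP/measurable_funM => /=.
    exact: (measurableT_comp mf measurable_fst).
  exact: (measurableT_comp mg measurable_snd).
rewrite /=.
under eq_integral => x _.
  under eq_integral => y _ do rewrite normrM EFinM.
  rewrite ge0_integralZl//; last by apply/measurable_EFinP/measurableT_comp.
  over.
rewrite ge0_integralZr//; last 2 first.
- by apply/measurable_EFinP/measurableT_comp.
- exact: integral_ge0.
apply: lte_mul_pinfty => //.
- exact: integral_ge0.
- rewrite ge0_fin_numE//; exact: integral_ge0.
Qed.

Lemma Cintegrable_prod_cis (h : T1 -> R[i]) (k : T2 -> R[i]) (t : T1 * T2 -> R) :
  Cintegrable m1 h -> Cintegrable m2 k -> measurable_fun setT t ->
  Cintegrable (m1 \x m2)%E (fun z => h z.1 * (k z.2 * cis (t z))).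
Proof.
move=> ih ik mt.
apply: (@le_Cintegrable _ _ _ _ _
  (fun z => l1norm (h z.1) * (l1norm (k z.2) * 2))).
- apply: CmeasurableM; last apply: CmeasurableM.
  + by apply: (Cmeasurable_comp measurable_fst); exact: Cintegrable_measurable ih.
  + by apply: (Cmeasurable_comp measurable_snd); exact: Cintegrable_measurable ik.
  + exact: Cmeasurable_cis.
- move=> z; rewrite (le_trans (l1normM _ _))// ler_wpM2l ?l1norm_ge0//.
  exact: l1normM_cis.
- apply: (@integrable_prodM (fun x => l1norm (h x)) (fun y => l1norm (k y) * 2)).
    exact: Cintegrable_l1norm.
  exact: (integrableZr measurableT 2 (Cintegrable_l1norm ik)).
Qed.

(** The phase is bounded, so the integrability of the two factors alone justifies the exchange. The
    second conclusion is used as often as the first: it supplies integrability, and even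
    measurability, of functions defined by an inner integral. *)
Lemma Cint_swap_cis (h : T1 -> R[i]) (k : T2 -> R[i]) (t : T1 -> T2 -> R) :
  Cintegrable m1 h -> Cintegrable m2 k ->
  measurable_fun setT (fun z => t z.1 z.2) ->
  Cint m1 (fun x => h x * Cint m2 (fun y => k y * cis (t x y))) =
  Cint m2 (fun y => k y * Cint m1 (fun x => h x * cis (t x y))) /\
  Cintegrable m1 (fun x => h x * Cint m2 (fun y => k y * cis (t x y))).
Proof.
move=> ih ik mt.
have mtx x : measurable_fun setT (t x).
  exact: (measurableT_comp mt (pair1_measurable x)).
have mty y : measurable_fun setT (t^~ y).
  exact: (measurableT_comp mt (pair2_measurable y)).
pose f z := h z.1 * (k z.2 * cis (t z.1 z.2)).
have fi : Cintegrable (m1 \x m2)%E f by exact: Cintegrable_prod_cis.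
have fx x : Cintegrable m2 (fun y => f (x, y)).
  apply: (@CintegrableZl _ _ _ m2 (fun y => k y * cis (t x y)) (h x)).
  exact: CintegrableM_cis.
have fyE y : (fun x => f (x, y)) = (fun x => k y * (h x * cis (t x y))).
  by apply/funext => x; rewrite /f/= mulrCA.
have fy y : Cintegrable m1 (fun x => f (x, y)).
  rewrite fyE; apply: (@CintegrableZl _ _ _ m1 (fun x => h x * cis (t x y))).
  exact: CintegrableM_cis.
have E : (fun x => h x * Cint m2 (fun y => k y * cis (t x y))) =
         (fun x => Cint m2 (fun y => f (x, y))).
  by apply/funext => x; rewrite -CintZl//; exact: CintegrableM_cis.
rewrite E; split; last exact: Cint_fubini_integrable.
rewrite Cint_swap//; congr Cint; apply/funext => y.
by rewrite fyE CintZl//; exact: CintegrableM_cis.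
Qed.

End product_integrable.

(** * Changes of variables and improper integrals *)

Section substitution.
Context (R : realType).
Local Notation mu := (@lebesgue_measure R).

(** The pushforward of Lebesgue measure under x |-> e x + s, scaled by |e|, has the right value on
    half-open intervals, hence is Lebesgue measure by uniqueness. *)
Lemma ge0_integral_affine (e s : R) (f : R -> \bar R) : e != 0 ->
  measurable_fun setT f -> (forall x, 0 <= f x)%E ->
  (\int[mu]_x f x = `|e|%:E * \int[mu]_x f (e * x + s)%R)%E.
Proof.
move=> e0 mf f0.
pose phi : measurableTypeR R -> measurableTypeR R := fun x => e * x + s.
have mphi : measurable_fun setT phi.
  by apply: measurable_funD => //; apply: measurable_funM.
have -> : (\int[mu]_x f (e * x + s)%R = \int[pushforward mu phi]_x f x)%E.
  by rewrite ge0_integral_pushforward.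
have ne0 : 0 <= `|e| by [].
rewrite -(ge0_integral_mscale _ measurableT (NngNum ne0))//.
apply: eq_measure_integral => A mA _.
apply: (lebesgue_measure_unique (mu := mscale (NngNum ne0) (pushforward mu phi))) => //.
move=> _ [[a b]] /= _ <-.
rewrite /mscale/= /pushforward.
have [e_gt0|e_lt0|/eqP] := ltgtP 0 e; last by rewrite eq_sym (negbTE e0).
- have -> : phi @^-1` `]a, b] = `](a - s) / e, (b - s) / e]%classic.
    apply/seteqP; split => x /=; rewrite !in_itv/= /phi => /andP[];
      rewrite ltr_pdivrMr// ler_pdivlMr// => h1 h2; apply/andP; split; lra.
  rewrite !lebesgue_measure_itv/= !lte_fin ltr_pM2r ?invr_gt0// ltrD2r.
  case: ifPn => // _; last by rewrite mule0.
  by rewrite -!EFinB -EFinM gtr0_norm//; congr EFin; field.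
(* A negative slope moves the closed end to the other side, which does not affect the length. *)
- have -> : phi @^-1` `]a, b] = `[(b - s) / e, (a - s) / e[%classic.
    apply/seteqP; split => x /=; rewrite !in_itv/= /phi => /andP[];
      rewrite ltr_ndivlMr// ler_ndivrMr// => h1 h2; apply/andP; split; lra.
  rewrite !lebesgue_measure_itv/= !lte_fin ltr_nM2r ?invr_lt0// ltrD2r.
  case: ifPn => // _; last by rewrite mule0.
  by rewrite -!EFinB -EFinM ltr0_norm//; congr EFin; field.
Qed.

Lemma Rintegral_affine (e s : R) (f : R -> R) : e != 0 ->
  mu.-integrable setT (EFin \o f) ->
  mu.-integrable setT (EFin \o (fun x => f (e * x + s))) /\
  \int[mu]_x f x = `|e| * \int[mu]_x f (e * x + s).
Proof.
move=> e0 /integrableP[mf foo].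
have mfe : measurable_fun setT (EFin \o (fun x => f (e * x + s))).
  by apply: measurableT_comp mf _; apply: measurable_funD => //;
    apply: measurable_funM.
have ife : mu.-integrable setT (EFin \o (fun x => f (e * x + s))).
  apply/integrableP; split => //.
  (* Integrability of the substituted function comes from applying the nonnegative case with the
     inverse affine map to its absolute value. *)
  have e0' : e^-1 != 0 by rewrite invr_eq0.
  have ma : measurable_fun setT (abse \o (EFin \o (fun x => f (e * x + s)))).
    exact: measurableT_comp.
  rewrite (ge0_integral_affine (- s / e) e0' ma)//=.
  apply: lte_mul_pinfty => //.
  under eq_integral => x _ do rewrite mulrDr mulrA mulfV// mul1r mulrCA mulfV// mulr1 subrK.
  exact: foo.
split => //.
have mf' : measurable_fun setT (EFin \o f) by exact: mf.
pose fe x := f (e * x + s).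
have Pe : (\int[mu]_x (EFin \o f)^\+ x = `|e|%:E * \int[mu]_x (EFin \o fe)^\+ x)%E.
  rewrite (ge0_integral_affine s e0)//; last exact: (measurable_funepos mf').
  by congr (_ * _)%E; apply: eq_integral => x _; rewrite unlock.
have Ne : (\int[mu]_x (EFin \o f)^\- x = `|e|%:E * \int[mu]_x (EFin \o fe)^\- x)%E.
  rewrite (ge0_integral_affine s e0)//; last exact: (measurable_funeneg mf').
  by congr (_ * _)%E; apply: eq_integral => x _; rewrite unlock.
have h1 : (\int[mu]_x (EFin \o fe)^\+ x)%E \is a fin_num.
  exact: (integrable_pos_fin_num measurableT ife).
have h2 : (\int[mu]_x (EFin \o fe)^\- x)%E \is a fin_num.
  exact: (integrable_neg_fin_num measurableT ife).
rewrite /Rintegral integralE Pe Ne [in RHS]integralE -(fineK h1) -(fineK h2).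
by rewrite /= mulrBr.
Qed.

Lemma Cint_affine (e s : R) (f : R -> R[i]) : e != 0 -> Cintegrable mu f ->
  Cintegrable mu (fun x => f (e * x + s)) /\
  Cint mu f = (`|e|)%:C * Cint mu (fun x => f (e * x + s)).
Proof.
move=> e0 [f1 f2].
have [i1 E1] := Rintegral_affine s e0 f1.
have [i2 E2] := Rintegral_affine s e0 f2.
split; first by split.
by apply: complexP; rewrite ?Re_mulc ?Im_mulc/= ?mul0r ?subr0 ?addr0.
Qed.

Lemma FTC_segment (f F : R -> R) (a b : R) : a <= b -> continuous f ->
  (forall x, is_derive x (1 : R) F (f x)) ->
  (\int[mu]_(x in `[a, b]) (f x)%:E = (F b - F a)%:E)%E.
Proof.
rewrite le_eqVlt => /predU1P[->|ab] cf dF.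
  by rewrite set_itv1 integral_set1 subrr.
have dcF x : derivable F x (1:R) by apply: ex_derive.
have cF : continuous F.
  by move=> x; apply/differentiable_continuous/derivable1_diffP.
rewrite (continuous_FTC2 ab _ _ _ (F := F)) ?EFinB//.
- exact: continuous_subspaceT.
- split => //.
  + by apply: cvg_at_right_filter; exact: cF.
  + by apply: cvg_at_left_filter; exact: cF.
- by move=> x _; rewrite derive1E derive_val.
Qed.

(** Monotone convergence along one exhausting sequence of segments; integrability is part of the
    conclusion, since the limit is finite. *)
Lemma ge0_integral_FTC (f F : R -> R) (u v : nat -> R) (D : set R) (l : R) :
  continuous f -> (forall x, is_derive x (1 : R) F (f x)) -> (forall x, 0 <= f x) ->
  (forall n, u n <= v n) -> nondecreasing_seq (fun n => `[u n, v n]%classic) ->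
  D = \bigcup_n `[u n, v n]%classic ->
  (fun n => F (v n) - F (u n)) @ \oo --> l ->
  (\int[mu]_(x in D) (f x)%:E = l%:E)%E.
Proof.
move=> cf dF f0 uv nd -> Fl.
have h : (\int[mu]_(x in `[u n, v n]) (f x)%:E @[n --> \oo] -->
    \int[mu]_(x in \bigcup_i `[u i, v i]%classic) (f x)%:E)%E.
  apply: ge0_nondecreasing_set_cvg_integral => [//|n|n|n x _].
  - exact: measurable_itv.
  - by apply/measurable_EFinP/measurable_funTS; exact: continuous_measurable_fun.
  - by rewrite lee_fin.
move: h; under eq_fun do rewrite (FTC_segment (uv _) cf dF).
move=> h; apply: (cvg_unique _ h) => //.
by apply: cvg_EFin; [exact: nearW|exact: Fl].
Qed.

(** Signed counterpart: the restrictions to the segments are eventually constant at each point of D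
    and dominated by |f|. *)
Lemma Rintegral_FTC (f F : R -> R) (u v : nat -> R) (D : set R) (l : R) :
  continuous f -> (forall x, is_derive x (1 : R) F (f x)) -> measurable D ->
  mu.-integrable D (EFin \o f) ->
  (forall n, u n <= v n) -> nondecreasing_seq (fun n => `[u n, v n]%classic) ->
  D = \bigcup_n `[u n, v n]%classic ->
  (fun n => F (v n) - F (u n)) @ \oo --> l ->
  \int[mu]_(x in D) f x = l.
Proof.
move=> cf dF mD fi uv nd DE Fl.
pose f_ n := (EFin \o f) \_ `[u n, v n]%classic.
have mf : measurable_fun setT f by exact: continuous_measurable_fun.
have h : (\int[mu]_(x in D) f_ n x @[n --> \oo] --> \int[mu]_(x in D) (f x)%:E)%E.
  apply: (@dominated_cvg _ _ _ mu D mD f_ (EFin \o f) (EFin \o (fun x => `|f x|))).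
  - move=> n; apply: measurable_funTS; apply/(measurable_restrictT (EFin \o f)) => //.
    by apply: measurable_funTS; exact/measurable_EFinP.
  - move=> x; rewrite {1}DE => -[n _ /= xn].
    apply: cvg_near_cst; exists n => // m /= nm.
    rewrite /f_ patchE mem_set//=.
    by move/subsetPset : (nd _ _ nm); apply.
  - by [].
  - exact: integrable_norm.
  - move=> n x Dx; rewrite /f_ patchE; case: ifPn => _ //=.
    by rewrite normr0 lee_fin.
have E n : (\int[mu]_(x in D) f_ n x = (F (v n) - F (u n))%:E)%E.
  rewrite -(FTC_segment (uv _) cf dF) /f_ -integral_mkcondr setIidr//.
  by move=> x /= xn; rewrite DE; exists n.
rewrite /Rintegral.
move: h; under eq_fun do rewrite E.
move=> h; have -> := cvg_unique _ h (cvg_EFin _ Fl) => //.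
exact: nearW.
Qed.

End substitution.

(** * Continuity and measurability of explicit formulas *)

Section calculus_rules.
Context (R : realType).
Implicit Types f g : R -> R.

Lemma continuous_addf (T : topologicalType) (f g : T -> R) x : continuous_at x f -> continuous_at x g ->
  continuous_at x (fun y => f y + g y).
Proof. by move=> ? ?; exact: continuousD. Qed.

Lemma continuous_oppf (T : topologicalType) (f : T -> R) x : continuous_at x f ->
  continuous_at x (fun y => - f y).
Proof. by move=> ?; exact: continuousN. Qed.

Lemma continuous_mulf (T : topologicalType) (f g : T -> R) x : continuous_at x f -> continuous_at x g ->
  continuous_at x (fun y => f y * g y).
Proof. by move=> ? ?; exact: continuousM. Qed.

Lemma continuous_expnf (T : topologicalType) (f : T -> R) n x : continuous_at x f ->
  continuous_at x (fun y => f y ^+ n).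
Proof. by move=> cf; exact: (continuous_comp cf (@exprn_continuous _ n _)). Qed.

Lemma continuous_invf (T : topologicalType) (f : T -> R) x : f x != 0 -> continuous_at x f ->
  continuous_at x (fun y => (f y)^-1).
Proof. by move=> ? ?; exact: continuousV. Qed.

Lemma continuous_normf (T : topologicalType) (f : T -> R) x : continuous_at x f ->
  continuous_at x (fun y => `|f y|).
Proof. by move=> cf; exact: (continuous_comp cf (@norm_continuous _ _ _)). Qed.

Lemma continuous_expf (T : topologicalType) (f : T -> R) x : continuous_at x f ->
  continuous_at x (fun y => expR (f y)).
Proof. by move=> cf; exact: (continuous_comp cf (@continuous_expR _ _)). Qed.

Lemma continuous_cosf (T : topologicalType) (f : T -> R) x : continuous_at x f ->
  continuous_at x (fun y => cos (f y)).
Proof. by move=> cf; exact: (continuous_comp cf (@continuous_cos _ _)). Qed.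

Lemma continuous_sinf (T : topologicalType) (f : T -> R) x : continuous_at x f ->
  continuous_at x (fun y => sin (f y)).
Proof. by move=> cf; exact: (continuous_comp cf (@continuous_sin _ _)). Qed.

Lemma continuous_lnf (T : topologicalType) (f : T -> R) x : 0 < f x -> continuous_at x f ->
  continuous_at x (fun y => ln (f y)).
Proof. by move=> f0 cf; exact: (continuous_comp cf (continuous_ln f0)). Qed.

Lemma measurable_compf d (T : measurableType d) (h : R -> R) (f : T -> R) :
  continuous h -> measurable_fun setT f -> measurable_fun setT (fun y => h (f y)).
Proof.
by move=> /continuous_measurable_fun ch mf; exact: measurableT_comp.
Qed.

End calculus_rules.

(** Nonvanishing of denominators and positivity under [ln] are left as goals, as is any subterm that
    no rule matches. *)
Ltac continuity_rules :=
  lazymatch goal with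
  | |- continuous_at _ (fun y => y) => exact: cvg_id
  | |- continuous_at _ (fun _ => ?c) => exact: cvg_cst
  | |- continuous_at _ (fun y => @?f y + @?g y) =>
      apply: (@continuous_addf _ _ f g); continuity_rules
  | |- continuous_at _ (fun y => - @?f y) =>
      apply: (@continuous_oppf _ _ f); continuity_rules
  | |- continuous_at _ (fun y => @?f y * @?g y) =>
      apply: (@continuous_mulf _ _ f g); continuity_rules
  | |- continuous_at _ (fun y => @?f y ^+ ?n) =>
      apply: (@continuous_expnf _ _ f n); continuity_rules
  | |- continuous_at _ (fun y => (@?f y)^-1) =>
      apply: (@continuous_invf _ _ f); [idtac|continuity_rules]
  | |- continuous_at _ (fun y => `|@?f y|) =>
      apply: (@continuous_normf _ _ f); continuity_rules
  | |- continuous_at _ (fun y => expR (@?f y)) =>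
      apply: (@continuous_expf _ _ f); continuity_rules
  | |- continuous_at _ (fun y => cos (@?f y)) =>
      apply: (@continuous_cosf _ _ f); continuity_rules
  | |- continuous_at _ (fun y => sin (@?f y)) =>
      apply: (@continuous_sinf _ _ f); continuity_rules
  | |- continuous_at _ (fun y => ln (@?f y)) =>
      apply: (@continuous_lnf _ _ f); [idtac|continuity_rules]
  | |- _ => idtac
  end.

Ltac measurability_rules :=
  lazymatch goal with
  | |- measurable_fun _ (fun y => y) => exact: measurable_id
  | |- measurable_fun _ (fun _ => ?c) => exact: measurable_cst
  | |- measurable_fun _ (fun y => y.1) => exact: measurable_fst
  | |- measurable_fun _ (fun y => y.2) => exact: measurable_snd
  | |- measurable_fun _ (fun y => @?f y + @?g y) =>
      apply: (@measurable_funD _ _ _ _ f g); measurability_rules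
  | |- measurable_fun _ (fun y => - @?f y) =>
      apply: (@measurable_funN _ _ _ _ f); measurability_rules
  | |- measurable_fun _ (fun y => @?f y * @?g y) =>
      apply: (@measurable_funM _ _ _ _ f g); measurability_rules
  | |- measurable_fun _ (fun y => @?f y ^+ ?n) =>
      apply: (@measurable_funX _ _ _ _ f n); measurability_rules
  | |- measurable_fun _ (fun y => `|@?f y|) =>
      apply: (measurable_compf (h := Num.norm) (f := f));
        [exact: (@norm_continuous _ _)|measurability_rules]
  | |- measurable_fun _ (fun y => expR (@?f y)) =>
      apply: (measurable_compf (h := expR) (f := f));
        [exact: (@continuous_expR _)|measurability_rules]
  | |- measurable_fun _ (fun y => cos (@?f y)) =>
      apply: (measurable_compf (h := cos) (f := f));
        [exact: (@continuous_cos _)|measurability_rules]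
  | |- measurable_fun _ (fun y => sin (@?f y)) =>
      apply: (measurable_compf (h := sin) (f := f));
        [exact: (@continuous_sin _)|measurability_rules]
  | |- _ => idtac
  end.

(** * The substitution x = exp r *)

Section exponential_substitution.
Context (R : realType).
Local Notation mu := (@lebesgue_measure R).

Lemma natr_archi (x : R) : exists n : nat, x <= n%:R.
Proof.
exists (Num.truncn `|x|).+1; rewrite (le_trans (ler_norm x))// ltW//.
exact: truncnS_gt.
Qed.

Lemma bigcup_itv_expN :
  \bigcup_n `[expR (- n%:R), expR n%:R]%classic = `]0, +oo[%classic :> set R.
Proof.
apply/seteqP; split => [x [n _]|x] /=; rewrite !in_itv/= ?andbT.
  by move=> /andP[+ _]; apply: lt_le_trans; exact: expR_gt0.
move=> x0; have [n hn] := natr_archi `|ln x|.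
exists n => //=; rewrite in_itv/= -{1}[x]lnK// -{2}[x]lnK// !ler_expR.
by move: hn; rewrite ler_norml.
Qed.

Lemma bigcup_itvN : \bigcup_n `[- n%:R, n%:R]%classic = setT :> set R.
Proof.
apply/seteqP; split => // x _; have [n hn] := natr_archi `|x|.
by exists n => //=; rewrite in_itv/=; move: hn; rewrite ler_norml.
Qed.

Lemma nondecreasing_itvs (u v : nat -> R) :
  (forall n m, (n <= m)%N -> u m <= u n) ->
  (forall n m, (n <= m)%N -> v n <= v m) ->
  nondecreasing_seq (fun n => `[u n, v n]%classic).
Proof.
move=> hu hv n m nm; apply/subsetPset => x /=; rewrite !in_itv/= => /andP[h1 h2].
by rewrite (le_trans (hu _ _ nm) h1) (le_trans h2 (hv _ _ nm)).
Qed.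

Lemma nondecreasing_itvN :
  nondecreasing_seq (fun n => `[- n%:R : R, n%:R]%classic).
Proof.
by apply: (@nondecreasing_itvs (fun n => - n%:R) (fun n => n%:R)) => n m nm;
  rewrite ?lerN2 ler_nat.
Qed.

Lemma derive1_expR : derive1 (@expR R) = expR.
Proof. by apply/funext => x; rewrite derive1E derive_val. Qed.

(** Continuity is asked only on the open half-line because the functions of interest may be singular
    at 0. The substitution is done between exp(-n) and exp(n), and monotone convergence is applied
    on both sides. *)
Lemma ge0_integral_expR (G : R -> R) :
  (forall x : R, 0 < x -> continuous_at x G) -> (forall x : R, 0 < x -> 0 <= G x) ->
  (\int[mu]_(x in `]0%R, +oo[) (G x)%:E =
   \int[mu]_r (G (expR r) * expR r)%:E)%E.
Proof.
move=> cG G0.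
have cH : continuous (fun r => G (expR r) * expR r).
  move=> r; apply: continuous_mulf; last exact: continuous_expR.
  by apply: (continuous_comp (@continuous_expR _ r)); apply: cG; exact: expR_gt0.
have seg n : (\int[mu]_(x in `[(expR (- n%:R))%R, (expR n%:R)%R]) (G x)%:E =
    \int[mu]_(r in `[(- n%:R)%R, (n%:R)%R]) (G (expR r) * expR r)%:E)%E.
  rewrite integration_by_substitution_increasing.
  - by apply: eq_integral => x _; rewrite /= derive1_expR.
  - by rewrite (@le_trans _ _ 0)// oppr_le0.
  - by move=> x y _ _; rewrite ltr_expR.
  - by rewrite derive1_expR => x _; exact: continuous_expR.
  - rewrite derive1_expR; apply/cvg_ex; eexists; apply: cvg_at_right_filter.
    exact: continuous_expR.
  - rewrite derive1_expR; apply/cvg_ex; eexists; apply: cvg_at_left_filter.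
    exact: continuous_expR.
  - split.
    + by move=> x _; exact: derivable_expR.
    + by apply: cvg_at_right_filter; exact: continuous_expR.
    + by apply: cvg_at_left_filter; exact: continuous_expR.
  - apply: continuous_in_subspaceT => x; rewrite inE/= in_itv/= => /andP[h _].
    by apply: cG; exact: lt_le_trans (expR_gt0 _) h.
have L : (\int[mu]_(x in `[(expR (- n%:R))%R, (expR n%:R)%R]) (G x)%:E @[n --> \oo] -->
    \int[mu]_(x in `]0%R, +oo[) (G x)%:E)%E.
  rewrite -bigcup_itv_expN; apply: ge0_nondecreasing_set_cvg_integral => [|n|n|n x].
  - by apply: (@nondecreasing_itvs (fun n => expR (- n%:R)) (fun n => expR (n%:R)))
      => n m nm; rewrite ler_expR ?lerN2 ler_nat.
  - exact: measurable_itv.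
  - apply/measurable_EFinP; apply: subspace_continuous_measurable_fun => //.
    apply: continuous_in_subspaceT => x; rewrite inE/= in_itv/= => /andP[h _].
    by apply: cG; exact: lt_le_trans (expR_gt0 _) h.
  - rewrite /= in_itv/= => /andP[h _]; rewrite lee_fin G0//.
    exact: lt_le_trans (expR_gt0 _) h.
have L' : (\int[mu]_(r in `[(- n%:R)%R, (n%:R)%R]) (G (expR r) * expR r)%:E @[n --> \oo] -->
    \int[mu]_r (G (expR r) * expR r)%:E)%E.
  rewrite -[X in _ --> (\int[_]_(x in X) _)%E]bigcup_itvN.
  apply: ge0_nondecreasing_set_cvg_integral => [|n|n|n x _].
  - exact: nondecreasing_itvN.
  - exact: measurable_itv.
  - by apply/measurable_EFinP/measurable_funTS; exact: continuous_measurable_fun.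
  - by rewrite lee_fin mulr_ge0 ?expR_ge0// G0// expR_gt0.
move: L; under eq_fun do rewrite seg.
by move=> L; exact: cvg_unique L L'.
Qed.

(** Positive and negative parts are transported separately, so both sides are [fine] of the same
    extended real and integrability never enters. *)
Lemma Rintegral_expR (G : R -> R) :
  (forall x : R, 0 < x -> continuous_at x G) ->
  \int[mu]_(x in `]0%R, +oo[) G x = \int[mu]_r (G (expR r) * expR r).
Proof.
move=> cG; rewrite /Rintegral integralE [in RHS]integralE; congr (fine (_ - _)).
- transitivity (\int[mu]_(x in `]0%R, +oo[) (Num.max (G x) 0)%:E)%E.
    by apply: eq_integral => x _; rewrite funeposE EFin_max.
  rewrite ge0_integral_expR.
  + apply: eq_integral => r _; rewrite funeposE -EFin_max; congr EFin.
    by rewrite maxr_pMl ?mul0r// expR_ge0.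
  + move=> x x0; apply: continuous_max => //; first exact: cG.
    exact: cvg_cst.
  + by move=> x _; rewrite le_max lexx orbT.
- transitivity (\int[mu]_(x in `]0%R, +oo[) (Num.max (- G x) 0)%:E)%E.
    by apply: eq_integral => x _; rewrite funenegE EFin_max.
  rewrite ge0_integral_expR.
  + apply: eq_integral => r _; rewrite funenegE -EFinN -EFin_max; congr EFin.
    by rewrite maxr_pMl ?mul0r ?mulNr// expR_ge0.
  + move=> x x0; apply: (@continuous_max _ _ (fun y => - G y) (cst 0)); last exact: cvg_cst.
    by apply: continuous_oppf; exact: cG.
  + by move=> x _; rewrite le_max lexx orbT.
Qed.

End exponential_substitution.

Section complex_real_product.
Context (R : realType).

Lemma Re_mulr (z : R[i]) (x : R) : complex.Re (z * x%:C) = complex.Re z * x.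
Proof. by rewrite Re_mulc /= mulr0 subr0. Qed.

Lemma Im_mulr (z : R[i]) (x : R) : complex.Im (z * x%:C) = complex.Im z * x.
Proof. by rewrite Im_mulc /= mulr0 add0r. Qed.

Lemma real_complexMr (x y : R) : x%:C * y%:C = (x * y)%:C.
Proof. by apply: complexP; rewrite ?Re_mulr ?Im_mulr//= mul0r. Qed.

End complex_real_product.

(** * Fourier inversion by Poisson summability *)

Section dominated.
Context d (T : measurableType d) (R : realType) (mu : {measure set T -> \bar R}).

Lemma Rintegral_dominated_cvg (f_ : nat -> T -> R) (f g : T -> R) :
  (forall n, measurable_fun setT (f_ n)) ->
  (forall x, (fun n => f_ n x) @ \oo --> f x) ->
  mu.-integrable setT (EFin \o g) ->
  (forall n x, `|f_ n x| <= g x) ->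
  (fun n => \int[mu]_x f_ n x) @ \oo --> \int[mu]_x f x.
Proof.
move=> mf ff ig fg; apply: fine_cvg.
rewrite fineK; last first.
  apply: integrable_fin_num => //.
  have mlim : measurable_fun setT f by exact: (measurable_fun_cvg mf) => x _; exact: ff.
  apply: le_integrable_EFin ig => // x.
  have h : (fun n => `|f_ n x|) @ \oo --> `|f x| by apply: cvg_norm; exact: ff.
  by apply: (cvgr_to_le h); exact: nearW.
apply: (@dominated_cvg _ _ _ mu setT measurableT (fun n => EFin \o f_ n) (EFin \o f) (EFin \o g)) => //.
- by move=> n; exact/measurable_EFinP.
- by move=> x _; apply: cvg_EFin; [exact: nearW|exact: ff].
- by move=> n x _; rewrite lee_fin.
Qed.

(** Abel-type regularization: the factors k n are bounded by 1 and tend to 1, so |Re h| and |Im h|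
    dominate. *)
Lemma Cint_mollified_cvg (h : T -> R[i]) (k : nat -> T -> R) :
  Cintegrable mu h -> (forall n, measurable_fun setT (k n)) ->
  (forall n x, `|k n x| <= 1) -> (forall x, (fun n => k n x) @ \oo --> (1 : R)) ->
  (fun n => complex.Re (Cint mu (fun x => h x * (k n x)%:C))) @ \oo -->
    complex.Re (Cint mu h) /\
  (fun n => complex.Im (Cint mu (fun x => h x * (k n x)%:C))) @ \oo -->
    complex.Im (Cint mu h).
Proof.
move=> ih mk k1 kl; have [mh1 mh2] := Cintegrable_measurable ih.
split.
- have -> : (fun n => complex.Re (Cint mu (fun x => h x * (k n x)%:C))) =
      (fun n => \int[mu]_x (complex.Re (h x) * k n x)).
    by apply/funext => n; apply: eq_Rintegral => x _; rewrite Re_mulr.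
  apply: (Rintegral_dominated_cvg (g := fun x => `|complex.Re (h x)|)).
  + by move=> n; exact: measurable_funM.
  + by move=> x; rewrite -[X in _ --> X]mulr1; apply: cvgMl_tmp.
  + exact: (integrable_norm ih.1).
  + by move=> n x; rewrite normrM ler_piMr.
- have -> : (fun n => complex.Im (Cint mu (fun x => h x * (k n x)%:C))) =
      (fun n => \int[mu]_x (complex.Im (h x) * k n x)).
    by apply/funext => n; apply: eq_Rintegral => x _; rewrite Im_mulr.
  apply: (Rintegral_dominated_cvg (g := fun x => `|complex.Im (h x)|)).
  + by move=> n; exact: measurable_funM.
  + by move=> x; rewrite -[X in _ --> X]mulr1; apply: cvgMl_tmp.
  + exact: (integrable_norm ih.2).
  + by move=> n x; rewrite normrM ler_piMr.
Qed.

End dominated.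

Section poisson_kernel.
Context (R : realType).
Local Notation mu := (@lebesgue_measure R).

Lemma cvg_expR_mulrN (e : R) : 0 < e -> (fun n : nat => expR (- (e * n%:R))) @ \oo --> (0 : R).
Proof.
move=> e0; under eq_fun do rewrite -mulNr expRM_natr.
apply: cvg_expr; rewrite ger0_norm ?expR_ge0// expR_lt1; lra.
Qed.

Lemma cvg0_mul_bounded (u v : nat -> R) (M : R) : u @ \oo --> (0 : R) ->
  (forall n, `|v n| <= M) -> (fun n => u n * v n) @ \oo --> (0 : R).
Proof.
move=> u0 vM; apply/norm_cvg0P.
apply: (@squeeze_cvgr _ _ _ _ (fun=> 0) (fun n => `|u n| * M)).
- by apply: nearW => n; rewrite normr_ge0/= normrM ler_wpM2l.
- exact: cvg_cst.
- rewrite -(mul0r M); apply: cvgMr_tmp; rewrite -(@normr0 _ R); exact: cvg_norm.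
Qed.

Lemma bigcup_itv0n : \bigcup_n `[0, n%:R]%classic = `[0, +oo[%classic :> set R.
Proof.
apply/seteqP; split => [x [n _]|x] /=; rewrite !in_itv/= ?andbT.
  by move=> /andP[].
by move=> x0; have [n hn] := natr_archi x; exists n => //=; rewrite in_itv/= x0.
Qed.

(** The regularizing factor of Poisson summability; it also serves throughout as the standard
    integrable majorant. *)
Definition laplace (e x : R) : R := expR (- (e * `|x|)).

Lemma measurable_laplace e : measurable_fun setT (laplace e).
Proof. by rewrite /laplace; measurability_rules. Qed.

(** Adding 1 to the cosine makes the integrand nonnegative, so the monotone form of the fundamental
    theorem applies before any integrability is known. The case x = 0 then yields integrability of
    [laplace], and subtracting its mass isolates the cosine transform. *)
Lemma integral_laplace_cos (e x : R) : 0 < e ->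
  (\int[mu]_u (laplace e u * (1 + cos (u * x)))%:E =
   (2 * (e^-1 + e / (e ^+ 2 + x ^+ 2)))%:E)%E.
Proof.
move=> e0.
have D0 : 0 < e ^+ 2 + x ^+ 2.
  by rewrite ltr_pwDl ?exprn_gt0 ?sqr_ge0.
have c1 (t : R) : 0 <= 1 + cos t.
  by have := cos_max t; rewrite ler_norml => /andP[]; lra.
rewrite ge0_symfun_integralT; last 3 first.
- by move=> u; rewrite mulr_ge0 ?expR_ge0.
- by move=> u; rewrite /laplace; continuity_rules.
- by move=> u; rewrite /laplace /= normrN mulNr cosN.
rewrite EFinM; congr (_ * _)%E.
pose f u := expR (- (e * u)) * (1 + cos (u * x)).
pose F u := - (expR (- (e * u)) / e) +
  expR (- (e * u)) * (x * sin (u * x) - e * cos (u * x)) / (e ^+ 2 + x ^+ 2).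
transitivity (\int[mu]_(u in `[0%R, +oo[) (f u)%:E)%E.
  rewrite -set_itvcy; apply: eq_integral => u; rewrite inE/= in_itv/= andbT => u0.
  by rewrite /laplace ger0_norm.
apply: (@ge0_integral_FTC _ f F (fun=> 0) (fun n => n%:R)).
- by move=> u; rewrite /f; continuity_rules.
- move=> u; apply: is_derive_eq; rewrite /f /GRing.scale /=; field; lra.
- by move=> u; rewrite mulr_ge0 ?expR_ge0.
- by move=> n.
- by apply: (@nondecreasing_itvs _ (fun=> 0) (fun n => n%:R)) => n m nm; rewrite ?ler_nat.
- by rewrite bigcup_itv0n.
- have -> : (fun n : nat => F n%:R - F 0) = (fun n : nat => expR (- (e * n%:R)) *
      (- e^-1 + (x * sin (n%:R * x) - e * cos (n%:R * x)) / (e ^+ 2 + x ^+ 2)) +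
      (e^-1 + e / (e ^+ 2 + x ^+ 2))).
    apply/funext => n; rewrite /F mulr0 oppr0 expR0 mul0r sin0 cos0; field; lra.
  rewrite -[X in _ --> X]add0r; apply: cvgD; last exact: cvg_cst.
  apply: (@cvg0_mul_bounded _ _ (e^-1 + (`|x| + e) / (e ^+ 2 + x ^+ 2))).
    exact: cvg_expR_mulrN.
  move=> n; rewrite (le_trans (ler_normD _ _))//.
  rewrite normrN normfV (gtr0_norm e0) lerD2l normrM normfV (gtr0_norm D0).
  rewrite ler_pM2r ?invr_gt0// (le_trans (ler_normB _ _))// !normrM (gtr0_norm e0).
  by apply: lerD; rewrite ler_piMr ?sin_max ?cos_max// ltW.
Qed.

Lemma integrable_laplace (e : R) : 0 < e -> mu.-integrable setT (EFin \o laplace e).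
Proof.
move=> e0; apply/integrableP; split; first by apply/measurable_EFinP; exact: measurable_laplace.
have := integral_laplace_cos 0 e0.
under eq_integral do rewrite mulr0 cos0 /=.
move=> h; apply: (@le_lt_trans _ _ (\int[mu]_u (laplace e u * (1 + 1))%:E)%E); last first.
  by rewrite h ltry.
apply: ge0_le_integral => //.
- by apply/measurable_EFinP; apply: measurableT_comp => //; exact: measurable_laplace.
- by apply/measurable_EFinP; apply: measurable_funM => //; exact: measurable_laplace.
- move=> x _ /=; rewrite lee_fin ger0_norm ?expR_ge0// /laplace.
  have := expR_ge0 (- (e * `|x|)); lra.
Qed.

Lemma Cint_laplace (e x : R) : 0 < e ->
  Cint mu (fun u => (laplace e u)%:C * cis (u * x)) =
  (2 * e / (e ^+ 2 + x ^+ 2))%:C.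
Proof.
move=> e0; have ie := integrable_laplace e0.
have D0 : 0 < e ^+ 2 + x ^+ 2.
  by rewrite ltr_pwDl ?exprn_gt0 ?sqr_ge0.
have [ic is_] : Cintegrable mu (fun u => (laplace e u)%:C * cis (u * x)).
  apply: CintegrableM_cis; first exact: Cintegrable_real.
  by measurability_rules.
have REf : (fun u => complex.Re ((laplace e u)%:C * cis (u * x))) = (fun u => laplace e u * cos (u * x)).
  by apply/funext => u; rewrite Re_mulc /= mul0r subr0.
have IMf : (fun u => complex.Im ((laplace e u)%:C * cis (u * x))) = (fun u => laplace e u * sin (u * x)).
  by apply/funext => u; rewrite Im_mulc /= mul0r addr0.
rewrite REf in ic; rewrite IMf in is_.
apply: complexP; rewrite /Cint/= ?REf ?IMf.
- have E y : \int[mu]_u (laplace e u * (1 + cos (u * y))) = 2 * (e^-1 + e / (e ^+ 2 + y ^+ 2)).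
    by rewrite /Rintegral integral_laplace_cos.
  have E0 : \int[mu]_u laplace e u = 2 / e.
    apply: (@mulIf _ 2) => //; rewrite -RintegralZr//.
    have := E 0; under eq_Rintegral do rewrite mulr0 cos0 -[1 + 1]/2.
    move=> ->; field; lra.
  have := E x; under eq_Rintegral do rewrite mulrDr mulr1.
  rewrite RintegralD// E0 => h; apply: (addrI (2 / e)); rewrite h; field; lra.
(* The sine part is odd: the substitution u |-> -u shows that its integral equals its own
   opposite. *)
- have n1 : -1 != 0 :> R by rewrite oppr_eq0 oner_eq0.
  have [_] := Rintegral_affine 0 n1 is_.
  rewrite normrN1 mul1r.
  have -> : (fun u => laplace e (-1 * u + 0) * sin ((-1 * u + 0) * x)) =
      (fun u => -1 * (laplace e u * sin (u * x))).
    by apply/funext => u; rewrite /laplace addr0 mulN1r normrN mulNr sinN mulrN mulN1r.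
  rewrite RintegralZl//; lra.
Qed.

End poisson_kernel.

Section fourier_inversion.
Context (R : realType).
Local Notation mu := (@lebesgue_measure R).

Lemma Cint_lebesgue_swap (h k : R -> R[i]) (t : R -> R -> R) :
  Cintegrable mu h -> Cintegrable mu k ->
  measurable_fun setT (fun z : R * R => t z.1 z.2) ->
  Cint mu (fun x => h x * Cint mu (fun y => k y * cis (t x y))) =
  Cint mu (fun y => k y * Cint mu (fun x => h x * cis (t x y))) /\
  Cintegrable mu (fun x => h x * Cint mu (fun y => k y * cis (t x y))).
Proof. exact: Cint_swap_cis. Qed.

(** This is the Poisson kernel rescaled to unit width; its mass is the constant 2 pi of the
    inversion formula. *)
Lemma integral_cauchy_density :
  (\int[mu]_q (2 / (1 + q ^+ 2))%:E = (2 * pi : R)%:E)%E.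
Proof.
have c1 q : 0 < 1 + q ^+ 2 :> R by rewrite ltr_pwDl ?sqr_ge0.
rewrite ge0_symfun_integralT; last 3 first.
- by move=> q; rewrite divr_ge0// ltW.
- by move=> q; continuity_rules; rewrite gt_eqF.
- by move=> q; rewrite /= sqrrN.
rewrite -set_itvcy; under eq_integral do rewrite EFinM.
have m0y : measurable (`[0%R, +oo[%classic : set R) by exact: measurable_itv.
rewrite (ge0_integralZl_EFin mu m0y)//.
- have := @integral0y_oneDsqr R; rewrite /oneDsqr => ->.
  by rewrite -!EFinM; congr EFin; field.
- by move=> q _; rewrite lee_fin invr_ge0 ltW.
- apply/measurable_EFinP; apply: measurable_funTS.
  by apply: continuous_measurable_fun; exact: continuous_oneDsqrV.
Qed.

Lemma integrable_cauchy_density :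
  mu.-integrable setT (EFin \o (fun q => 2 / (1 + q ^+ 2))).
Proof.
have c1 q : 0 < 1 + q ^+ 2 :> R by rewrite ltr_pwDl ?sqr_ge0.
apply/integrableP; split.
  apply/measurable_EFinP; apply: measurable_funM => //.
  by apply: continuous_measurable_fun; exact: continuous_oneDsqrV.
under eq_integral do rewrite /= ger0_norm ?divr_ge0 ?(ltW (c1 _))//.
by rewrite integral_cauchy_density ltry.
Qed.

Variables (phi : R -> R) (M : R).
Hypothesis phi_int : mu.-integrable setT (EFin \o phi).
Hypothesis phi_cont : continuous phi.
Hypothesis phi_bnd : forall r, `|phi r| <= M.

Let phihat (u : R) := Cint mu (fun w => (phi w)%:C * cis (- (u * w))).
Hypothesis phihat_int : Cintegrable mu phihat.

(** Fubini moves the factor [laplace e] inside, where its transform is the Poisson kernel centred at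
    r; the substitution w = e q + r then makes the kernel independent of e and puts the dependence
    on e into phi. *)
Let poisson_phi (e r : R) : 0 < e ->
  Cint mu (fun u => phihat u * cis (u * r) * (laplace e u)%:C) =
  (\int[mu]_q (phi (e * q + r) * (2 / (1 + q ^+ 2))))%:C.
Proof.
move=> e0.
have c1 q : 0 < 1 + q ^+ 2 :> R by rewrite ltr_pwDl ?sqr_ge0.
have D0 x : 0 < e ^+ 2 + x ^+ 2 by rewrite ltr_pwDl ?exprn_gt0 ?sqr_ge0.
have i1 : Cintegrable mu (fun u => (laplace e u)%:C * cis (u * r)).
  apply: CintegrableM_cis; last by measurability_rules.
  by apply: Cintegrable_real; exact: integrable_laplace.
have i2 : Cintegrable mu (fun w => (phi w)%:C) by exact: Cintegrable_real.
have mt : measurable_fun setT (fun z : R * R => - (z.1 * z.2)) by measurability_rules.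
have [sw si] := Cint_lebesgue_swap (t := fun u w : R => - (u * w)) i1 i2 mt.
transitivity (Cint mu (fun u => (laplace e u)%:C * cis (u * r) * phihat u)).
  by apply: eq_Cint => u; rewrite mulrC -mulrA [phihat _ * _]mulrC mulrA.
rewrite sw.
have E w : (phi w)%:C * Cint mu (fun u => (laplace e u)%:C * cis (u * r) * cis (- (u * w))) =
   (phi w * (2 * e / (e ^+ 2 + (r - w) ^+ 2)))%:C.
  rewrite -real_complexMr -(Cint_laplace _ e0); congr (_ * _).
  by apply: eq_Cint => u; rewrite -mulrA -cisD -mulrBr.
under eq_Cint do rewrite E.
rewrite Cint_real; congr (_%:C).
(* Integrability of phi against the Poisson kernel is read off the second conclusion of the exchange
   lemma with the two variables in the opposite roles. *)
have ik : mu.-integrable setT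
    (EFin \o (fun w => phi w * (2 * e / (e ^+ 2 + (r - w) ^+ 2)))).
  have -> : (fun w => phi w * (2 * e / (e ^+ 2 + (r - w) ^+ 2))) =
      (fun w => complex.Re ((phi w)%:C * Cint mu (fun u => (laplace e u)%:C * cis (u * r) * cis (- (u * w))))).
    by apply/funext => w; rewrite E.
  have mt' : measurable_fun setT (fun z : R * R => - (z.2 * z.1)) by measurability_rules.
  exact: (Cint_lebesgue_swap (t := fun w u : R => - (u * w)) i2 i1 mt').2.1.
have en0 : e != 0 by rewrite gt_eqF.
have [ik' ->] := Rintegral_affine r en0 ik.
rewrite (gtr0_norm e0) -(RintegralZl e measurableT ik'); apply: eq_Rintegral => q _.
field; by apply/andP; split; rewrite gt_eqF ?D0 ?c1.
Qed.

(** Both sides of [poisson_phi] converge as e tends to 0: the left one dominated through the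
    integrable [phihat], the right one by M times the Cauchy density. Uniqueness of limits
    concludes. *)
Lemma fourier_inversion (r : R) :
  Cint mu (fun u => phihat u * cis (u * r)) = (2 * pi * phi r)%:C.
Proof.
have ih : Cintegrable mu (fun u => phihat u * cis (u * r)).
  by apply: CintegrableM_cis => //; measurability_rules.
pose e (n : nat) : R := n.+1%:R^-1.
have e0 n : 0 < e n by rewrite invr_gt0 ltr0n.
have e_cvg : e @ \oo --> (0 : R) by exact: cvg_harmonic.
have mk n : measurable_fun setT (laplace (e n)) by exact: measurable_laplace.
have k1 n x : `|laplace (e n) x| <= 1.
  by rewrite ger0_norm ?expR_ge0// expR_le1 oppr_le0 mulr_ge0// ltW.
have kl x : (fun n => laplace (e n) x) @ \oo --> (1 : R).
  have h : (fun n => - (e n * `|x|)) @ \oo --> - (0 * `|x|) by apply: cvgN; apply: cvgMr_tmp.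
  rewrite mul0r oppr0 in h.
  by rewrite /laplace -expR0; apply: continuous_cvg h; exact: continuous_expR.
have [lR lI] := Cint_mollified_cvg ih mk k1 kl.
have E n : Cint mu (fun u => phihat u * cis (u * r) * (laplace (e n) u)%:C) =
    (\int[mu]_q (phi (e n * q + r) * (2 / (1 + q ^+ 2))))%:C.
  exact: poisson_phi.
have mphi : measurable_fun setT phi by exact: continuous_measurable_fun.
have c1 q : 0 < 1 + q ^+ 2 :> R by rewrite ltr_pwDl ?sqr_ge0.
have lim : (fun n => \int[mu]_q (phi (e n * q + r) * (2 / (1 + q ^+ 2)))) @ \oo -->
    2 * pi * phi r.
  have -> : 2 * pi * phi r = \int[mu]_q (phi r * (2 / (1 + q ^+ 2))).
    rewrite RintegralZl//; last exact: integrable_cauchy_density.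
    by rewrite /Rintegral integral_cauchy_density mulrC.
  apply: (Rintegral_dominated_cvg (mu := mu)
    (f_ := fun n q => phi (e n * q + r) * (2 / (1 + q ^+ 2)))
    (f := fun q => phi r * (2 / (1 + q ^+ 2)))
    (g := fun q => M * (2 / (1 + q ^+ 2)))).
  - move=> n; apply: measurable_funM.
      by apply: measurableT_comp => //; measurability_rules.
    by apply/measurable_EFinP; exact: (measurable_int _ integrable_cauchy_density).
  - move=> q; have h : (fun n => e n * q + r) @ \oo --> 0 * q + r.
      by apply: cvgD; [exact: cvgMr_tmp|exact: cvg_cst].
    rewrite mul0r add0r in h.
    by apply: cvgMr_tmp; apply: continuous_cvg h; exact: phi_cont.
  - exact: (integrable_EFinZl M integrable_cauchy_density).
  - move=> n q; have d0 : 0 <= 2 / (1 + q ^+ 2) by rewrite divr_ge0// ltW.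
    by rewrite normrM (ger0_norm d0) ler_wpM2r.
apply: complexP.
- move: lR; under eq_fun do rewrite E /=.
  by move=> lR; exact: cvg_unique lR lim.
- move: lI; under eq_fun do rewrite E /=.
  by move=> lI; exact: cvg_unique lI (cvg_cst _).
Qed.

End fourier_inversion.

(** * The gamma function on vertical lines *)

Section gamma_function.
Context (R : realType).
Local Notation mu := (@lebesgue_measure R).
Implicit Types (p u r : R).

(* The integrand of Euler's integral in the variable r = ln t. *)
Definition eulerfun p r : R := expR (p * r - expR r).

Lemma eulerfun_ge0 p r : 0 <= eulerfun p r.
Proof. exact: expR_ge0. Qed.

Lemma continuous_eulerfun p : continuous (eulerfun p).
Proof. by move=> r; rewrite /eulerfun; continuity_rules. Qed.

Lemma measurable_eulerfun p : measurable_fun setT (eulerfun p).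
Proof. by rewrite /eulerfun; measurability_rules. Qed.

Lemma eulerfunS p r : expR r * eulerfun p r = eulerfun (p + 1) r.
Proof. by rewrite /eulerfun -expRD; congr expR; ring. Qed.

(** The claim is p r - e^r <= 4 p^2 - p |r|. For r >= 0, e^r is the square of e^(r/2) >= r/2, and
    (r/2 - 2p)^2 >= 0 gives 2 p r <= r^2/4 + 4 p^2; for r < 0 the term -e^r is simply dropped. *)
Lemma eulerfun_le_laplace p r : 0 < p ->
  eulerfun p r <= expR (4 * p ^+ 2) * laplace p r.
Proof.
move=> p0; rewrite /eulerfun /laplace -expRD ler_expR.
have := expR_gt0 r.
have [r0|r0] := leP 0 r.
  have : expR r = expR (r / 2) ^+ 2 by rewrite -expRM_natl; congr expR; field.
  have := expR_ge1Dx (r / 2); rewrite ger0_norm//.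
  set x := expR (r / 2) => h -> _.
  have : (r / 2) ^+ 2 <= x ^+ 2.
    by rewrite ler_pXn2r ?nnegrE ?expR_ge0//; lra.
  have := sqr_ge0 (r / 2 - 2 * p); nra.
rewrite ltr0_norm//; have := sqr_ge0 p; nra.
Qed.

Lemma eulerfun_bounded p r : 0 < p -> eulerfun p r <= expR (4 * p ^+ 2).
Proof.
move=> p0; rewrite (le_trans (eulerfun_le_laplace r p0))// ler_piMr ?expR_ge0//.
by rewrite expR_le1 oppr_le0 mulr_ge0// ltW.
Qed.

Lemma integrable_eulerfun p : 0 < p -> mu.-integrable setT (EFin \o eulerfun p).
Proof.
move=> p0.
apply: (le_integrable_EFin _ _ (integrable_EFinZl (expR (4 * p ^+ 2)) (integrable_laplace p0))).
  exact: measurable_eulerfun.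
by move=> r; rewrite ger0_norm ?eulerfun_ge0// eulerfun_le_laplace.
Qed.

Definition mellin_gamma p u : R[i] := Cint mu (fun r => (eulerfun p r)%:C * cis (u * r)).

Lemma Cintegrable_eulerfun p : 0 < p -> Cintegrable mu (fun r => (eulerfun p r)%:C).
Proof. by move=> p0; apply: Cintegrable_real; exact: integrable_eulerfun. Qed.

Lemma Cintegrable_eulerfun_cis p u : 0 < p ->
  Cintegrable mu (fun r => (eulerfun p r)%:C * cis (u * r)).
Proof.
move=> p0; apply: CintegrableM_cis; first exact: Cintegrable_eulerfun.
by measurability_rules.
Qed.

Lemma GammaE p u : Gamma (p +i* u) = mellin_gamma p u.
Proof.
apply: complexP.
- transitivity (\int[mu]_(t in `]0, +oo[)
      (expR ((p - 1) * ln t) * cos (u * ln t) * expR (- t))).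
    apply: eq_Rintegral => t _; rewrite Re_mulr /=.
    by rewrite subr0.
  rewrite Rintegral_expR; last by move=> t t0; continuity_rules.
  apply: eq_Rintegral => r _; rewrite Re_mulc /= mul0r subr0 expRK /eulerfun.
  have -> : p * r - expR r = (p - 1) * r + (- expR r) + r by ring.
  by rewrite !expRD; ring.
- transitivity (\int[mu]_(t in `]0, +oo[)
      (expR ((p - 1) * ln t) * sin (u * ln t) * expR (- t))).
    apply: eq_Rintegral => t _; rewrite Im_mulr /=.
    by rewrite subr0.
  rewrite Rintegral_expR; last by move=> t t0; continuity_rules.
  apply: eq_Rintegral => r _; rewrite Im_mulc /= mul0r addr0 expRK /eulerfun.
  have -> : p * r - expR r = (p - 1) * r + (- expR r) + r by ring.
  by rewrite !expRD; ring.
Qed.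

Lemma cvg_eulerfun_mul_bounded p (v : R -> R) : 0 < p -> (forall r, `|v r| <= 1) ->
  (fun n : nat => eulerfun p n%:R * v n%:R - eulerfun p (- n%:R) * v (- n%:R)) @ \oo --> (0 : R).
Proof.
move=> p0 v1; apply/norm_cvg0P.
have h : (fun n : nat => 2 * expR (4 * p ^+ 2) * expR (- (p * n%:R))) @ \oo --> (0 : R).
  rewrite -(mulr0 (2 * expR (4 * p ^+ 2))); apply: cvgMl_tmp.
  exact: cvg_expR_mulrN.
apply: (squeeze_cvgr _ (cvg_cst 0) h).
apply: nearW => n; rewrite normr_ge0/=.
rewrite (le_trans (ler_normB _ _))// !normrM !(ger0_norm (eulerfun_ge0 _ _)).
have b r : eulerfun p r * `|v r| <= expR (4 * p ^+ 2) * laplace p r.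
  rewrite -[leRHS]mulr1; apply: ler_pM => //; first exact: eulerfun_ge0.
  exact: eulerfun_le_laplace.
have := b n%:R; have := b (- n%:R); rewrite /laplace !normrN !(ger0_norm (ler0n _ n)); lra.
Qed.

(** Integration by parts: the derivative of [eulerfun p] is p [eulerfun p] - [eulerfun (p + 1)], and
    the boundary terms vanish. It is applied to v = cos(u r) and v = sin(u r). *)
Lemma Rintegral_eulerfun_deriv p (v dv : R -> R) : 0 < p ->
  (forall r, `|v r| <= 1) -> continuous v -> continuous dv ->
  (forall r, is_derive r (1 : R) v (dv r)) ->
  mu.-integrable setT (EFin \o (fun r => eulerfun p r * v r)) ->
  mu.-integrable setT (EFin \o (fun r => eulerfun p r * dv r)) ->
  mu.-integrable setT (EFin \o (fun r => eulerfun (p + 1) r * v r)) ->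
  p * (\int[mu]_r (eulerfun p r * v r)) + \int[mu]_r (eulerfun p r * dv r) =
  \int[mu]_r (eulerfun (p + 1) r * v r).
Proof.
move=> p0 v1 cv cdv dv_ i1 i2 i3; apply/eqP; rewrite -subr_eq0; apply/eqP.
have pi1 := integrable_EFinZl p i1.
have i12 : mu.-integrable setT
    (EFin \o (fun r => p * (eulerfun p r * v r) + eulerfun p r * dv r)).
  exact: (integrableD measurableT pi1 i2).
rewrite -(RintegralZl p measurableT i1) -(RintegralD measurableT pi1 i2).
rewrite -(RintegralB measurableT i12 i3).
apply: (@Rintegral_FTC _ _ (fun r => eulerfun p r * v r) (fun n => - n%:R) (fun n => n%:R)) => //.
- move=> r; have c1 : continuous_at r (eulerfun p) by exact: continuous_eulerfun.
  have c2 : continuous_at r (eulerfun (p + 1)) by exact: continuous_eulerfun.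
  have c3 : continuous_at r v by exact: cv.
  have c4 : continuous_at r dv by exact: cdv.
  by continuity_rules.
- move=> r; rewrite -eulerfunS.
  have de : is_derive r (1 : R) (eulerfun p) (eulerfun p r * (p - expR r)).
    by apply: is_derive_eq; rewrite /eulerfun /GRing.scale /=; ring.
  apply: is_derive_eq; rewrite /GRing.scale /=; ring.
- exact: (integrableB measurableT i12 i3).
- by move=> n; rewrite (@le_trans _ _ 0)// oppr_le0.
- exact: nondecreasing_itvN.
- by rewrite bigcup_itvN.
- exact: cvg_eulerfun_mul_bounded.
Qed.

(** The functional equation z Gamma(z) = Gamma(z + 1), obtained for the real and imaginary parts
    separately. *)
Lemma mellin_gammaS p u : 0 < p ->
  (p +i* u) * mellin_gamma p u = mellin_gamma (p + 1) u.
Proof.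
move=> p0; have p1 : 0 < p + 1 by lra.
have [ic0 is0] := Cintegrable_eulerfun_cis u p0.
have [ic1 is1] := Cintegrable_eulerfun_cis u p1.
have REf q : (fun r => complex.Re ((eulerfun q r)%:C * cis (u * r))) = (fun r => eulerfun q r * cos (u * r)).
  by apply/funext => r; rewrite Re_mulc /= mul0r subr0.
have IMf q : (fun r => complex.Im ((eulerfun q r)%:C * cis (u * r))) = (fun r => eulerfun q r * sin (u * r)).
  by apply/funext => r; rewrite Im_mulc /= mul0r addr0.
rewrite !REf in ic0 ic1; rewrite !IMf in is0 is1.
have Es : (fun r => eulerfun p r * (- u * sin (u * r))) = (fun r => - u * (eulerfun p r * sin (u * r))).
  by apply/funext => r; rewrite mulrCA.
have Ec : (fun r => eulerfun p r * (u * cos (u * r))) = (fun r => u * (eulerfun p r * cos (u * r))).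
  by apply/funext => r; rewrite mulrCA.
apply: complexP; rewrite ?Re_mulc ?Im_mulc /mellin_gamma /Cint/= ?REf ?IMf.
- have <- : p * (\int[mu]_r (eulerfun p r * cos (u * r))) +
      \int[mu]_r (eulerfun p r * (- u * sin (u * r))) =
      \int[mu]_r (eulerfun (p + 1) r * cos (u * r)); last first.
    by rewrite Es (RintegralZl _ measurableT is0) mulNr.
  apply: (@Rintegral_eulerfun_deriv p (fun r => cos (u * r)) (fun r => - u * sin (u * r))) => //.
  + by move=> r; exact: cos_max.
  + by move=> r; continuity_rules.
  + by move=> r; continuity_rules.
  + by move=> r; apply: is_derive_eq; rewrite /GRing.scale /=; ring.
  + by rewrite Es; exact: integrable_EFinZl.
- have <- : p * (\int[mu]_r (eulerfun p r * sin (u * r))) +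
      \int[mu]_r (eulerfun p r * (u * cos (u * r))) =
      \int[mu]_r (eulerfun (p + 1) r * sin (u * r)); last first.
    by rewrite Ec (RintegralZl _ measurableT ic0).
  apply: (@Rintegral_eulerfun_deriv p (fun r => sin (u * r)) (fun r => u * cos (u * r))) => //.
  + by move=> r; exact: sin_max.
  + by move=> r; continuity_rules.
  + by move=> r; continuity_rules.
  + by move=> r; apply: is_derive_eq; rewrite /GRing.scale /=; ring.
  + by rewrite Ec; exact: integrable_EFinZl.
Qed.

Lemma mellin_gamma_bounded p u : 0 < p ->
  l1norm (mellin_gamma p u) <= \int[mu]_r (2 * eulerfun p r).
Proof.
move=> p0; have ic := Cintegrable_eulerfun_cis u p0.
apply: (le_trans (l1norm_Cint_le ic)); apply: le_Rintegral => //.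
- exact: Cintegrable_l1norm.
- by apply: integrable_EFinZl; exact: integrable_eulerfun.
- move=> r _; apply: (le_trans (l1normM_cis _ _)).
  by rewrite l1norm_real ger0_norm ?eulerfun_ge0// mulrC.
Qed.

(** Multiplying the functional equation by the conjugate p - iu leaves a real nonnegative factor,
    which [l1norm] scales exactly. *)
Lemma mellin_gamma_decayS p u : 0 < p ->
  (p ^+ 2 + u ^+ 2) * l1norm (mellin_gamma p u) <=
  (p + `|u|) * l1norm (mellin_gamma (p + 1) u).
Proof.
move=> p0; rewrite -mellin_gammaS//; set w := mellin_gamma p u.
have -> : (p ^+ 2 + u ^+ 2) * l1norm w = l1norm ((p +i* - u) * ((p +i* u) * w)).
  have -> : (p +i* - u) * ((p +i* u) * w) = w * (p ^+ 2 + u ^+ 2)%:C.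
    by apply: complexP; rewrite !(Re_mulc, Im_mulc) /=; ring.
  rewrite /l1norm Re_mulr Im_mulr !normrM -mulrDl mulrC.
  by rewrite (ger0_norm (addr_ge0 (sqr_ge0 _) (sqr_ge0 _))).
by rewrite (le_trans (l1normM _ _))// /l1norm /= normrN (gtr0_norm p0).
Qed.

(** Here x, y, z stand for the norms of Gamma at abscissas p, p + 1, p + 2 and t for |u|. One step
    of the recurrence gains only 1/t, which is not integrable; two steps reach the decay of the
    Cauchy density. *)
Lemma decay_from_recurrence p (t x y z K : R) : 0 < p -> 0 <= t -> 0 <= x -> 0 <= z ->
  (p ^+ 2 + t ^+ 2) * x <= (p + t) * y ->
  ((p + 1) ^+ 2 + t ^+ 2) * y <= (p + 1 + t) * z -> z <= K ->
  x <= K * (1 + (p ^+ 2)^-1) * (2 / (1 + t ^+ 2)).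
Proof.
move=> p0 t0 x0 z0 h1 h2 h3.
have p1 : 0 < p + 1 by lra.
have c1 : 0 < 1 + t ^+ 2 by rewrite ltr_pwDl ?sqr_ge0.
have D1 : 0 < p ^+ 2 + t ^+ 2 by rewrite ltr_pwDl ?exprn_gt0 ?sqr_ge0.
have D2 : 0 < (p + 1) ^+ 2 + t ^+ 2 by rewrite ltr_pwDl ?exprn_gt0 ?sqr_ge0.
have K0 : 0 <= K by exact: le_trans h3.
(* The factor 2 comes from (p + t)(p + 1 + t) <= (p + 1 + t)^2 <= 2 ((p + 1)^2 + t^2). *)
have h4 : (p ^+ 2 + t ^+ 2) * x <= 2 * K.
  rewrite -(ler_pM2l D2); apply: (@le_trans _ _ ((p + t) * (p + 1 + t) * K)).
    apply: (@le_trans _ _ ((p + t) * (((p + 1) ^+ 2 + t ^+ 2) * y))).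
      by rewrite [leRHS]mulrCA; apply: ler_wpM2l h1; exact: ltW.
    rewrite -mulrA; apply: ler_wpM2l; first lra.
    by apply: (le_trans h2); apply: ler_wpM2l h3; lra.
  rewrite mulrA; apply: ler_wpM2r => //.
  have := sqr_ge0 (p + 1 - t); nra.
have ip : 0 < (p ^+ 2)^-1 by rewrite invr_gt0 exprn_gt0.
have h5 : 1 + t ^+ 2 <= (1 + (p ^+ 2)^-1) * (p ^+ 2 + t ^+ 2).
  rewrite mulrDl mul1r mulrDr mulVf ?gt_eqF ?exprn_gt0//.
  have := sqr_ge0 p; have : 0 <= (p ^+ 2)^-1 * t ^+ 2 by rewrite mulr_ge0 ?sqr_ge0 ?ltW.
  lra.
rewrite mulrA ler_pdivlMr//; apply: (le_trans (ler_wpM2l x0 h5)).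
have -> : x * ((1 + (p ^+ 2)^-1) * (p ^+ 2 + t ^+ 2)) =
  (1 + (p ^+ 2)^-1) * ((p ^+ 2 + t ^+ 2) * x) by ring.
have -> : K * (1 + (p ^+ 2)^-1) * 2 = (1 + (p ^+ 2)^-1) * (2 * K) by ring.
by apply: ler_wpM2l h4; lra.
Qed.

Lemma mellin_gamma_decay p : 0 < p -> exists K, forall u,
  l1norm (mellin_gamma p u) <= K * (2 / (1 + u ^+ 2)).
Proof.
move=> p0; have p1 : 0 < p + 1 by lra.
have p2 : 0 < p + 1 + 1 by lra.
eexists => u.
have u2 : u ^+ 2 = `|u| ^+ 2 by rewrite -normrX ger0_norm ?sqr_ge0.
have h1 := mellin_gamma_decayS u p0.
have h2 := mellin_gamma_decayS u p1.
rewrite u2 in h1 h2 *.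
exact: (decay_from_recurrence p0 (normr_ge0 u) (l1norm_ge0 _) (l1norm_ge0 _) h1 h2
  (mellin_gamma_bounded u p2)).
Qed.

(** A parameter integral is measurable by Fubini once the parameter carries an integrable weight;
    the weight e^(-|u|) is inserted for that purpose and divided out again. *)
Lemma measurable_mellin_gamma p : 0 < p -> Cmeasurable (mellin_gamma p).
Proof.
move=> p0.
have ih : Cintegrable mu (fun u => (laplace 1 u)%:C).
  by apply: Cintegrable_real; exact: integrable_laplace.
have mt : measurable_fun setT (fun z : R * R => z.1 * z.2) by measurability_rules.
have [_ /Cintegrable_measurable mh] := Cint_lebesgue_swap
  (t := fun u r : R => u * r) ih (Cintegrable_eulerfun p0) mt.
have -> : mellin_gamma p = (fun u => (laplace 1 u)%:C * mellin_gamma p u * (expR `|u|)%:C).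
  apply/funext => u; rewrite mulrAC real_complexMr /laplace mul1r -expRD addNr expR0.
  by rewrite mul1r.
apply: CmeasurableM => //.
by apply: Cmeasurable_real; measurability_rules.
Qed.

Lemma Cintegrable_mellin_gammaN p : 0 < p ->
  Cintegrable mu (fun u => mellin_gamma p (- u)).
Proof.
move=> p0; have [K hK] := mellin_gamma_decay p0.
apply: (@le_Cintegrable _ _ _ mu (fun u => mellin_gamma p (- u)) (fun u => K * (2 / (1 + u ^+ 2)))).
- apply: Cmeasurable_comp; last exact: measurable_mellin_gamma.
  by measurability_rules.
- by move=> u; have := hK (- u); rewrite sqrrN.
- by apply: integrable_EFinZl; exact: integrable_cauchy_density.
Qed.

(** The Cahen-Mellin integral, which recovers exp(-e^r) from Gamma on a vertical line, in
    logarithmic variables. The sign in [- u] matches the arguments -s and -t of the Meijer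
    integrand. *)
Lemma mellin_gamma_inversion p r : 0 < p ->
  Cint mu (fun u => mellin_gamma p (- u) * cis (u * r)) = (2 * pi * eulerfun p r)%:C.
Proof.
move=> p0.
have E u : mellin_gamma p (- u) = Cint mu (fun w => (eulerfun p w)%:C * cis (- (u * w))).
  by apply: eq_Cint => w; rewrite mulNr.
under eq_Cint do rewrite E.
apply: (@fourier_inversion _ (eulerfun p) (expR (4 * p ^+ 2))).
- exact: integrable_eulerfun.
- exact: continuous_eulerfun.
- by move=> w; rewrite ger0_norm ?eulerfun_ge0// eulerfun_bounded.
- have := Cintegrable_mellin_gammaN p0.
  by congr Cintegrable; apply/funext => u; exact: E.
Qed.

End gamma_function.

(** * The kernel behind Gamma(p) Gamma(1 - p) *)

Section beta_kernel.
Context (R : realType).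
Local Notation mu := (@lebesgue_measure R).

Definition betafun (p w : R) : R := expR (p * w) / (1 + expR w).

Lemma betafun_ge0 p w : 0 <= betafun p w.
Proof. by rewrite divr_ge0 ?addr_ge0 ?expR_ge0. Qed.

(** The exponents 1 - p and p add up to 1, so the powers of e^q collapse to a single e^q and the
    integrand is an exact derivative. *)
Lemma integral_eulerfun_correlation (p w : R) :
  (\int[mu]_q (eulerfun (1 - p) q * eulerfun p (w + q))%:E = (betafun p w)%:E)%E.
Proof.
pose A := 1 + expR w.
have A0 : 0 < A by rewrite ltr_pwDl ?expR_ge0.
pose F q := - (expR (p * w) * expR (- (A * expR q)) / A).
apply: (@ge0_integral_FTC _ _ F (fun n => - n%:R) (fun n => n%:R)).
- by move=> q; rewrite /eulerfun; continuity_rules.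
- move=> q.
  have -> : eulerfun (1 - p) q * eulerfun p (w + q) =
      expR (p * w) * expR q * expR (- (A * expR q)).
    by rewrite /eulerfun -!expRD; congr expR; rewrite /A expRD; ring.
  by apply: is_derive_eq; rewrite /GRing.scale /=; field; lra.
- by move=> q; rewrite mulr_ge0 ?eulerfun_ge0.
- by move=> n; rewrite (@le_trans _ _ 0)// oppr_le0.
- exact: nondecreasing_itvN.
- by rewrite bigcup_itvN.
- have h0 : (fun n : nat => expR (- n%:R) : R) @ \oo --> (0 : R).
    by have := cvg_expR_mulrN (@ltr01 R); under eq_fun do rewrite mul1r.
  have hm : (fun n : nat => expR (- (A * expR (- n%:R))) : R) @ \oo --> (1 : R).
    have h : (fun n : nat => - (A * expR (- n%:R))) @ \oo --> - (A * 0).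
      by apply: cvgN; apply: cvgMl_tmp.
    rewrite mulr0 oppr0 in h; rewrite -[X in _ --> X]expR0.
    exact: (cvg_comp _ _ h (@continuous_expR R 0)).
  have hp : (fun n : nat => expR (- (A * expR n%:R)) : R) @ \oo --> (0 : R).
    apply: (squeeze_cvgr _ (cvg_cst 0) (cvg_expR_mulrN A0)).
    apply: nearW => n; rewrite expR_ge0/= ler_expR lerN2 ler_pM2l//.
    by have := expR_ge1Dx (n%:R : R); lra.
  have -> : (fun n : nat => F n%:R - F (- n%:R)) = (fun n : nat =>
      betafun p w * (expR (- (A * expR (- n%:R))) - expR (- (A * expR n%:R)))).
    by apply/funext => n; rewrite /F /betafun -/A; field; lra.
  rewrite -[X in _ --> X]mulr1 -[X in _ * X]subr0.
  by apply: cvgMl_tmp; apply: cvgB.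
Qed.

Section correlation.
Variables (p : R).
Hypotheses (p0 : 0 < p) (p1 : p < 1).
Let p1' : 0 < 1 - p. Proof. by rewrite subr_gt0. Qed.

Let corr (z : R * R) : R := eulerfun (1 - p) z.1 * eulerfun p (z.2 + z.1).

Let meas2 : measurable_fun setT corr.
Proof. by rewrite /corr /eulerfun; measurability_rules. Qed.

(** Integrating first in w meets only a translate of [eulerfun p], so Tonelli gives a product of two
    finite masses. *)
Let int2 : (mu \x mu)%E.-integrable setT (EFin \o corr).
Proof.
apply/integrable12ltyP; first by apply/measurable_EFinP; exact: meas2.
have E q : (\int[mu]_w `|(EFin \o corr) (q, w)|
   = (eulerfun (1 - p) q)%:E * \int[mu]_w (eulerfun p w)%:E)%E.
  have one0 : 1 != 0 :> R by [].
  rewrite [in RHS](ge0_integral_affine q one0); last 2 first.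
  - by apply/measurable_EFinP; exact: measurable_eulerfun.
  - by move=> w; rewrite lee_fin eulerfun_ge0.
  rewrite normr1 mul1e -ge0_integralZl//; last 3 first.
  - apply/measurable_EFinP; rewrite /eulerfun; measurability_rules.
  - by move=> w _; rewrite lee_fin eulerfun_ge0.
  - by rewrite lee_fin eulerfun_ge0.
  apply: eq_integral => w _ /=.
  by rewrite ger0_norm ?mulr_ge0 ?eulerfun_ge0// mul1r.
under eq_integral do rewrite E.
have /integrableP[_ h1] := integrable_eulerfun p1'.
have /integrableP[_ h2] := integrable_eulerfun p0.
rewrite ge0_integralZr//; last 3 first.
- by apply/measurable_EFinP; exact: measurable_eulerfun.
- by move=> w _; rewrite lee_fin eulerfun_ge0.
- by apply: integral_ge0 => w _; rewrite lee_fin eulerfun_ge0.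
have g (q : R) : (\int[mu]_w (eulerfun q w)%:E = \int[mu]_w `|(EFin \o eulerfun q) w|)%E.
  by apply: eq_integral => w _; rewrite /= ger0_norm ?eulerfun_ge0.
rewrite !g; apply: lte_mul_pinfty => //; first exact: integral_ge0.
by rewrite ge0_fin_numE//; exact: integral_ge0.
Qed.

Let f (t : R) (z : R * R) : R[i] :=
  (corr z)%:C * cis (t * z.2).

Let f_int t : Cintegrable (mu \x mu)%E (f t).
Proof.
apply: CintegrableM_cis; first exact: Cintegrable_real int2.
by measurability_rules.
Qed.

Let f_int1 t q : Cintegrable mu (fun w => f t (q, w)).
Proof.
rewrite /f /corr /=; apply: CintegrableM_cis; last by measurability_rules.
apply: Cintegrable_real; apply: integrable_EFinZl.
have one0 : 1 != 0 :> R by [].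
have [h _] := Rintegral_affine q one0 (integrable_eulerfun p0).
by move: h; under eq_fun do rewrite mul1r.
Qed.

Let f_int2 t w : Cintegrable mu (fun q => f t (q, w)).
Proof.
rewrite /f /corr /=; apply: CintegrableM_cis; last by measurability_rules.
apply: Cintegrable_real.
apply: (le_integrable_EFin _ _ (integrable_EFinZl (expR (4 * p ^+ 2)) (integrable_eulerfun p1'))).
  by rewrite /eulerfun; measurability_rules.
move=> q; rewrite ger0_norm ?mulr_ge0 ?eulerfun_ge0// mulrC ler_wpM2r ?eulerfun_ge0//.
exact: eulerfun_bounded.
Qed.

Lemma Rintegral_eulerfun_correlation w :
  \int[mu]_q (eulerfun (1 - p) q * eulerfun p (w + q)) = betafun p w.
Proof. by rewrite /Rintegral integral_eulerfun_correlation. Qed.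

(** Decay is e^(p w) on the left and e^(-(1 - p) w) on the right, which is where 0 < p < 1
    enters. *)
Lemma integrable_betafun : mu.-integrable setT (EFin \o betafun p).
Proof.
have il : mu.-integrable setT (EFin \o (fun w => laplace p w + laplace (1 - p) w)).
  exact: (integrableD measurableT (integrable_laplace p0) (integrable_laplace p1')).
apply: (le_integrable_EFin _ _ il).
  apply: continuous_measurable_fun => w.
  by rewrite /betafun; continuity_rules; rewrite gt_eqF// ltr_pwDl ?expR_ge0.
move=> w; rewrite ger0_norm ?betafun_ge0//.
have e0 := expR_gt0 w; rewrite /betafun ler_pdivrMr; last lra.
have l1 := expR_gt0 (- (p * `|w|)); have l2 := expR_gt0 (- ((1 - p) * `|w|)).
rewrite /laplace; have [w0|/ltW w0] := leP 0 w.
  have -> : expR (p * w) = expR (- ((1 - p) * `|w|)) * expR w.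
    by rewrite -expRD ger0_norm//; congr expR; ring.
  by apply: ler_pM; lra.
have -> : expR (p * w) = expR (- (p * `|w|)) * 1.
  by rewrite mulr1 ler0_norm//; congr expR; ring.
by apply: ler_pM; lra.
Qed.

(** A product of transforms at opposite frequencies is the transform of a correlation: after
    translating by q, the phases [cis (t * (w + q))] and [cis (- t * q)] combine to
    [cis (t * w)]. *)
Lemma mellin_gamma_reflection t :
  mellin_gamma p t * mellin_gamma (1 - p) (- t) =
  Cint mu (fun w => (betafun p w)%:C * cis (t * w)).
Proof.
have one0 : 1 != 0 :> R by [].
transitivity (Cint mu (fun q => Cint mu (fun w => f t (q, w)))).
  rewrite -CintZl; last exact: Cintegrable_eulerfun_cis.
  apply: eq_Cint => q.
  have [i1 e1] := Cint_affine q one0 (Cintegrable_eulerfun_cis t p0).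
  rewrite {1}/mellin_gamma e1 normr1 mul1r mulrC -CintZl//.
  apply: eq_Cint => w; rewrite /f /corr /= mul1r -real_complexMr.
  rewrite mulrACA -cisD; congr (_ * cis _); ring.
rewrite (@Cint_swap _ _ _ _ _ mu mu (f t))//.
apply: eq_Cint => w; rewrite /f /corr /= CintZr.
  by rewrite Cint_real Rintegral_eulerfun_correlation.
have := f_int2 0 w; rewrite /f /=.
by congr Cintegrable; apply/funext => q; rewrite mul0r cis0 mulr1.
Qed.

End correlation.
End beta_kernel.

(** * The Mellin-Barnes integral *)

Section meijer.
Context (R : realType).
Local Notation mu := (@lebesgue_measure R).

Lemma CpowE (x a u : R) :
  Cpow x (a +i* u) = (expR (a * ln x))%:C * cis (u * ln x).
Proof. by apply: complexP; rewrite ?Re_mulc ?Im_mulc /= mul0r ?subr0 ?addr0. Qed.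

Lemma half_complex : (2^-1 : R[i]) = (2^-1 : R)%:C.
Proof. by rewrite fmorphV rmorph_nat. Qed.

Lemma three_halves_complex : (3 / 2 : R[i]) = (3 / 2 : R)%:C.
Proof. by rewrite rmorphM fmorphV !rmorph_nat. Qed.

(** The two factors i come from ds = i du and dt = i dv; their sign cancels that of (2 pi i)^2. *)
Lemma two_pi_i_normalization (p : R) (z : R[i]) : p != 0 ->
  (2 * p%:C * (0 +i* 1)) ^- 2 * ((0 +i* 1) * ((0 +i* 1) * z)) =
  ((4 * p ^+ 2)^-1)%:C * z.
Proof.
move=> p0; rewrite fmorphV.
have -> : (2 * p%:C * (0 +i* 1)) ^+ 2 = - (4 * p ^+ 2)%:C.
  rewrite -[2](rmorph_nat (real_complex R)) real_complexMr expr2.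
  by apply: complexP; rewrite !(Re_mulc, Im_mulc) /=; ring.
have -> : (0 +i* 1) * ((0 +i* 1) * z) = - z.
  by apply: complexP; rewrite !(Re_mulc, Im_mulc) /=; ring.
by rewrite invrN mulrNN.
Qed.

Lemma four_pi_sqr_cancel (p x y z : R) : p != 0 ->
  x * y * z = (4 * p ^+ 2)^-1 * (x * (2 * p * y) * (2 * p * z)).
Proof. by move=> p0; field. Qed.

Section product_of_gammas.
Variables (q : R).
Hypothesis q0 : 0 < q.
Let q1 : 0 < q + 1. Proof. exact: addr_gt0. Qed.

(** The convolution whose transform is Gamma(1/2 - t) Gamma(-1/2 - t) on the line Re t = b when q =
    -1/2 - b; up to an exponential factor it is a modified Bessel function K_1. *)
Definition bessel_conv (s : R) : R :=
  \int[mu]_r (eulerfun q r * eulerfun (q + 1) (s - r)).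

Lemma integrable_bessel_conv (s : R) :
  mu.-integrable setT (EFin \o (fun r => eulerfun q r * eulerfun (q + 1) (s - r))).
Proof.
apply: (le_integrable_EFin _ _ (integrable_EFinZl (expR (4 * (q + 1) ^+ 2)) (integrable_eulerfun q0))).
  by rewrite /eulerfun; measurability_rules.
move=> r; rewrite ger0_norm ?mulr_ge0 ?eulerfun_ge0// mulrC ler_wpM2r ?eulerfun_ge0//.
exact: eulerfun_bounded.
Qed.

(** Only the factor Gamma(q - iv) is expanded into its Euler integral; after Fubini the other factor
    is inverted at the shifted point s - r. *)
Lemma mellin_gamma_product_inversion (s : R) :
  Cint mu (fun v => mellin_gamma (q + 1) (- v) * mellin_gamma q (- v) * cis (v * s)) =
  (2 * pi * bessel_conv s)%:C.
Proof.
have ih : Cintegrable mu (fun v => mellin_gamma (q + 1) (- v) * cis (v * s)).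
  apply: CintegrableM_cis; first exact: Cintegrable_mellin_gammaN.
  by measurability_rules.
have ik := Cintegrable_eulerfun q0.
have mt : measurable_fun setT (fun z : R * R => - (z.1 * z.2)) by measurability_rules.
have [sw _] := Cint_lebesgue_swap (t := fun v r : R => - (v * r)) ih ik mt.
transitivity (Cint mu (fun v => mellin_gamma (q + 1) (- v) * cis (v * s) *
    Cint mu (fun r => (eulerfun q r)%:C * cis (- (v * r))))).
  apply: eq_Cint => v; rewrite mulrAC; congr (_ * _).
  by apply: eq_Cint => r; rewrite mulNr.
rewrite sw.
have E r : (eulerfun q r)%:C * Cint mu (fun v => mellin_gamma (q + 1) (- v) * cis (v * s) * cis (- (v * r)))
    = (2 * pi * (eulerfun q r * eulerfun (q + 1) (s - r)))%:C.
  have -> : 2 * pi * (eulerfun q r * eulerfun (q + 1) (s - r)) =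
    eulerfun q r * (2 * pi * eulerfun (q + 1) (s - r)) by ring.
  rewrite -real_complexMr -(mellin_gamma_inversion (s - r) q1); congr (_ * _).
  by apply: eq_Cint => v; rewrite -mulrA -cisD -mulrBr.
transitivity (Cint mu (fun r => (2 * pi * (eulerfun q r * eulerfun (q + 1) (s - r)))%:C)).
  by apply: eq_Cint => r; exact: E.
by rewrite Cint_real (RintegralZl (2 * pi) measurableT (integrable_bessel_conv s)).
Qed.

Lemma Cintegrable_mellin_gamma_product (s : R) :
  Cintegrable mu (fun v => mellin_gamma (q + 1) (- v) * mellin_gamma q (- v) * cis (v * s)).
Proof.
apply: CintegrableM_cis; last by measurability_rules.
apply: (@CintegrableM_bounded _ _ _ mu (fun v => mellin_gamma (q + 1) (- v))
  (fun v => mellin_gamma q (- v)) (\int[mu]_r (2 * eulerfun q r))).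
- exact: Cintegrable_mellin_gammaN.
- by have := Cintegrable_measurable (Cintegrable_mellin_gammaN q0).
- by move=> v; exact: mellin_gamma_bounded.
Qed.

End product_of_gammas.

(** [betafun] comes from the coupled pair of gammas, [bessel_conv] from the two gammas in t alone,
    [eulerfun (- a)] from Gamma(-s), and the remaining exponentials are x^a y^b. *)
Definition meijer_integrand (a b x y w : R) : R :=
  betafun (3 / 2 + a + b) w * bessel_conv (- 2^-1 - b) (w + ln y) *
  (expR (a * ln x) * expR (b * ln y) * eulerfun (- a) (w + ln x)).

Lemma meijerG2_real (a b x y : R) : admissible_contours a b ->
  mu.-integrable setT (EFin \o meijer_integrand a b x y) /\
  meijerG2 a b x y = (\int[mu]_w meijer_integrand a b x y w)%:C.
Proof.
move=> [a0 b0 ab1 ab2].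
(* The four contour conditions say exactly that p > 0, p < 1, q > 0 and -a > 0, so every gamma is
   evaluated in the right half-plane. *)
set p := 3 / 2 + a + b; set q := - 2^-1 - b.
have p0 : 0 < p by rewrite /p; lra.
have p1 : p < 1 by rewrite /p; lra.
have q0 : 0 < q by rewrite /q; lra.
have na0 : 0 < - a by lra.
pose A1 u := ((expR (a * ln x) * expR (b * ln y))%:C * mellin_gamma (- a) (- u)) * cis (u * ln x).
pose A2 v := mellin_gamma (q + 1) (- v) * mellin_gamma q (- v) * cis (v * ln y).
have iA1 : Cintegrable mu A1.
  apply: CintegrableM_cis; last by measurability_rules.
  by apply: CintegrableZl; exact: Cintegrable_mellin_gammaN.
have iA2 : Cintegrable mu A2 by exact: Cintegrable_mellin_gamma_product.
have ib : Cintegrable mu (fun w => (betafun p w)%:C).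
  by apply: Cintegrable_real; exact: integrable_betafun.
(* This separates the variables: A1 sees only u, A2 only v, and the coupled pair becomes an integral
   over w of a product of phases. *)
have F u v : Gamma (3 / 2 + (a +i* u) + (b +i* v)) * Gamma (- 2^-1 - (a +i* u) - (b +i* v))
    * Gamma (- (a +i* u)) * Gamma (2^-1 - (b +i* v)) * Gamma (- 2^-1 - (b +i* v))
    * Cpow x (a +i* u) * Cpow y (b +i* v) =
  A1 u * (A2 v * Cint mu (fun w => ((betafun p w)%:C * cis (u * w)) * cis (v * w))).
  have -> : 3 / 2 + (a +i* u) + (b +i* v) = p +i* (u + v).
    by rewrite three_halves_complex; apply: complexP; rewrite /p /=; ring.
  have -> : - 2^-1 - (a +i* u) - (b +i* v) = (1 - p) +i* (- (u + v)).
    by rewrite half_complex; apply: complexP; rewrite /p /=; field.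
  have -> : - (a +i* u) = (- a) +i* (- u) by [].
  have -> : - 2^-1 - (b +i* v) = q +i* (- v).
    by rewrite half_complex; apply: complexP; rewrite /q /=; ring.
  have -> : 2^-1 - (b +i* v) = (q + 1) +i* (- v).
    by rewrite half_complex; apply: complexP; rewrite /q /=; field.
  rewrite !GammaE mellin_gamma_reflection// !CpowE /A1 /A2 -real_complexMr.
  have -> : Cint mu (fun w => (betafun p w)%:C * cis ((u + v) * w)) =
      Cint mu (fun w => (betafun p w)%:C * cis (u * w) * cis (v * w)).
    by apply: eq_Cint => w; rewrite mulrDl cisD mulrA.
  by ring.
have mt : measurable_fun setT (fun z : R * R => z.1 * z.2) by measurability_rules.
have mt' : measurable_fun setT (fun z : R * R => z.2 * z.1) by measurability_rules.
pose K w := betafun p w * (2 * pi * bessel_conv q (w + ln y)).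
have A2E w : Cint mu (fun v => A2 v * cis (v * w)) = (2 * pi * bessel_conv q (w + ln y))%:C.
  rewrite -(mellin_gamma_product_inversion q0 (w + ln y)); apply: eq_Cint => v.
  by rewrite /A2 -mulrA -cisD -mulrDr (addrC w).
(* Integrating out v produces K; its integrability, needed for the second exchange between u and w,
   is a by-product of the first. *)
have iK : Cintegrable mu (fun w => (K w)%:C).
  have [_] := Cint_lebesgue_swap (t := fun w v : R => v * w) ib iA2 mt'.
  congr Cintegrable; apply/funext => w.
  by rewrite /K -real_complexMr -A2E.
have inner u : vline_integral b (fun t =>
    Gamma (3 / 2 + (a +i* u) + t) * Gamma (- 2^-1 - (a +i* u) - t)
    * Gamma (- (a +i* u)) * Gamma (2^-1 - t) * Gamma (- 2^-1 - t)
    * Cpow x (a +i* u) * Cpow y t) =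
    (0 +i* 1) * (A1 u * Cint mu (fun w => (K w)%:C * cis (u * w))).
  rewrite /vline_integral; congr (_ * _).
  have iu : Cintegrable mu (fun w => (betafun p w)%:C * cis (u * w)).
    by apply: CintegrableM_cis => //; measurability_rules.
  have [sw si] := Cint_lebesgue_swap (t := fun v w : R => v * w) iA2 iu mt.
  transitivity (Cint mu (fun v => A1 u * (A2 v *
      Cint mu (fun w => ((betafun p w)%:C * cis (u * w)) * cis (v * w))))).
    by apply: eq_Cint => v; exact: F.
  rewrite (CintZl _ si) sw; congr (_ * _); apply: eq_Cint => w.
  by rewrite A2E mulrAC real_complexMr.
pose g w := K w * (2 * pi * (expR (a * ln x) * expR (b * ln y) * eulerfun (- a) (w + ln x))).
have gE w : (K w)%:C * Cint mu (fun u => A1 u * cis (u * w)) = (g w)%:C.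
  rewrite /g -[RHS]real_complexMr; congr (_ * _).
  have -> : 2 * pi * (expR (a * ln x) * expR (b * ln y) * eulerfun (- a) (w + ln x)) =
    expR (a * ln x) * expR (b * ln y) * (2 * pi * eulerfun (- a) (w + ln x)) by ring.
  rewrite -[RHS]real_complexMr -(mellin_gamma_inversion (w + ln x) na0) -CintZl; last first.
    apply: CintegrableM_cis; last by measurability_rules.
    exact: Cintegrable_mellin_gammaN.
  by apply: eq_Cint => u; rewrite /A1 -!mulrA -cisD -mulrDr (addrC w).
have [outer iO] := Cint_lebesgue_swap (t := fun u w : R => u * w) iA1 iK mt.
have ig : mu.-integrable setT (EFin \o g).
  have [_] := Cint_lebesgue_swap (t := fun w u : R => u * w) iK iA1 mt'.
  by rewrite (funext gE) => -[].
have pi0 : (pi : R) != 0 by exact: lt0r_neq0 (pi_gt0 R).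
have mE w : meijer_integrand a b x y w = (4 * pi ^+ 2)^-1 * g w.
  exact: four_pi_sqr_cancel.
split; first by rewrite (funext mE); exact: integrable_EFinZl.
rewrite (funext mE) (RintegralZl _ measurableT ig).
rewrite /meijerG2 {1}/vline_integral.
transitivity ((2 * (pi : R)%:C * (0 +i* 1)) ^- 2 * ((0 +i* 1) * Cint mu (fun u =>
    (0 +i* 1) * (A1 u * Cint mu (fun w => (K w)%:C * cis (u * w)))))).
  by congr (_ * (_ * _)); apply: eq_Cint => u; exact: inner.
rewrite (CintZl _ iO) outer.
have -> : Cint mu (fun w => (K w)%:C * Cint mu (fun u => A1 u * cis (u * w))) =
    (\int[mu]_w g w)%:C.
  by rewrite -Cint_real; apply: eq_Cint => w; exact: gE.
by rewrite (two_pi_i_normalization _ pi0) real_complexMr.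
Qed.

End meijer.

(** * The Bessel integral *)

Section bessel.
Context (R : realType).
Local Notation mu := (@lebesgue_measure R).

(** This is 2 sqrt(Y) K_1(2 sqrt(Y)) for Y > 0, written in the variable r = ln t. *)
Definition besselfun (Y : R) : R := \int[mu]_r expR (r - expR r - Y * expR (- r)).

(** The reflection r |-> s - r gathers all dependence on q into e^(q s), so the contour abscissa
    leaves the integral. *)
Lemma bessel_convE (q s : R) : 0 < q ->
  bessel_conv q s = expR (q * s) * besselfun (expR s) /\
  mu.-integrable setT (EFin \o (fun r => expR (r - expR r - expR s * expR (- r)))).
Proof.
move=> q0; have n1 : -1 != 0 :> R by rewrite oppr_eq0 oner_eq0.
have [ii E] := Rintegral_affine s n1 (integrable_bessel_conv q0 s).
have F r : eulerfun q (-1 * r + s) * eulerfun (q + 1) (s - (-1 * r + s)) =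
    expR (q * s) * expR (r - expR r - expR s * expR (- r)).
  rewrite /eulerfun -!expRD; congr expR; rewrite [-1 * r + s]addrC mulN1r.
  by rewrite opprD addNKr opprK expRD; ring.
rewrite (funext F) in ii.
have i2 : mu.-integrable setT (EFin \o (fun r => expR (r - expR r - expR s * expR (- r)))).
  have := integrable_EFinZl (expR (- (q * s))) ii.
  congr (_.-integrable _ (EFin \o _)); apply/funext => r.
  by rewrite mulrA -expRD addNr expR0 mul1r.
split=> //; rewrite /bessel_conv E normrN1 mul1r.
under eq_Rintegral do rewrite F.
exact: RintegralZl.
Qed.

Definition hop_integrand (B k v : R) : R := expR (- (B * v)) * expR (- (k / v)).

Lemma integrable_hop (B k : R) : 0 < B -> 0 < k ->
  mu.-integrable `]0, +oo[ (EFin \o hop_integrand B k).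
Proof.
move=> B0 k0.
apply: (@le_integrable _ _ _ mu _ _ _ (EFin \o laplace B)) => //.
- apply/measurable_EFinP; apply: open_continuous_measurable_fun.
    exact: interval_open.
  move=> v; rewrite inE/= in_itv/= andbT => v0.
  by rewrite /hop_integrand; continuity_rules; rewrite gt_eqF.
- move=> v; rewrite /= in_itv/= andbT => v0; rewrite lee_fin /hop_integrand /laplace.
  rewrite !ger0_norm ?mulr_ge0 ?expR_ge0// ?(ltW v0)//.
  by rewrite ler_piMr ?expR_ge0// expR_le1 oppr_le0 divr_ge0 ?ltW.
- exact: (integrableS measurableT _ _ (integrable_laplace B0)).
Qed.

Lemma Rintegral_hop (B k : R) : 0 < B -> 0 < k ->
  \int[mu]_(v in `]0, +oo[) hop_integrand B k v = B^-1 * besselfun (B * k).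
Proof.
move=> B0 k0; have Bk0 : 0 < B * k by exact: mulr_gt0.
rewrite Rintegral_expR; last first.
  by move=> v v0; rewrite /hop_integrand; continuity_rules; rewrite gt_eqF.
pose h r := hop_integrand B k (expR r) * expR r.
have one0 : 1 != 0 :> R by [].
(* Only the integrability statement is taken, and it does not mention q; the value 1 is an arbitrary
   positive choice. *)
have [_ ib] := @bessel_convE 1 (ln (B * k)) ltr01.
have hE r : h (1 * r + - ln B) = B^-1 * expR (r - expR r - expR (ln (B * k)) * expR (- r)).
  rewrite /h /hop_integrand mul1r lnK ?posrE// !expRD [expR (- ln B)]expRN lnK ?posrE//.
  have er := expR_gt0 r.
  have -> : B * (expR r / B) = expR r by field; rewrite gt_eqF.
  have -> : k / (expR r / B) = B * k * expR (- r).
    by rewrite expRN; field; rewrite !gt_eqF.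
  by ring.
have ih : mu.-integrable setT (EFin \o h).
  have i0 : mu.-integrable setT (EFin \o (fun r => h (1 * r + - ln B))).
    by rewrite (funext hE); exact: integrable_EFinZl.
  have [i1 _] := Rintegral_affine (ln B) one0 i0.
  move: i1; congr (_.-integrable _ (EFin \o _)); apply/funext => r.
  by rewrite !mul1r addrK.
have [_ ->] := Rintegral_affine (- ln B) one0 ih.
rewrite normr1 mul1r; under eq_Rintegral do rewrite hE.
rewrite (RintegralZl _ measurableT ib) /besselfun.
by under eq_Rintegral do rewrite lnK ?posrE//.
Qed.

End bessel.

Section meijer_double_integral.
Context (R : realType).
Local Notation mu := (@lebesgue_measure R).

Definition capacity_term (B k zeta w : R) : R := expR w / (1 + expR w) *
  \int[mu]_(v in `]0, +oo[) (expR (- (B * (zeta * expR w))) * hop_integrand B (k * expR w) v).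

(** Both sides are the same Bessel value over 1 + e^w times an exponential. Collecting exponents
    cancels a and b, and sqrt(k / B) times (B k)^(-1/2) leaves the 1/B produced by the integral over
    v. *)
Lemma meijer_integrandE (a b B k zeta w : R) : admissible_contours a b ->
  0 < B -> 0 < k -> 0 < zeta ->
  capacity_term B k zeta w =
  Num.sqrt (k / B) * meijer_integrand a b (B * zeta) (B * k) w.
Proof.
move=> [a0 b0 ab1 ab2] B0 k0 z0.
have q0 : 0 < - 2^-1 - b by lra.
have kw0 : 0 < k * expR w by rewrite mulr_gt0 ?expR_gt0.
rewrite /capacity_term (RintegralZl _ _ (integrable_hop B0 kw0))//.
rewrite (Rintegral_hop B0 kw0) /meijer_integrand (bessel_convE _ q0).1.
have Bk0 : 0 < B * k by exact: mulr_gt0.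
have -> : expR (w + ln (B * k)) = B * (k * expR w).
  by rewrite expRD lnK ?posrE//; ring.
set H := besselfun _; rewrite /betafun /eulerfun.
have -> : Num.sqrt (k / B) = expR ((ln k - ln B) / 2).
  have -> : k / B = expR ((ln k - ln B) / 2) ^+ 2.
    transitivity (expR (ln k - ln B)); first by rewrite expRB !lnK ?posrE.
    by rewrite -expRM_natl; congr expR; field.
  by rewrite sqrtr_sqr ger0_norm ?expR_ge0.
have -> : B^-1 = expR (- ln B) by rewrite expRN lnK.
have -> : expR (w + ln (B * zeta)) = B * (zeta * expR w).
  by rewrite expRD lnK ?posrE ?mulr_gt0//; ring.
rewrite [ln (B * k)]lnM ?posrE//; set L := ln (B * zeta); set C := (1 + expR w)^-1.
set X := B * (zeta * expR w).
transitivity (C * H * expR (w - X - ln B)).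
  by rewrite !expRD; ring.
transitivity (C * H * expR ((ln k - ln B) / 2 + (3 / 2 + a + b) * w +
    (- 2^-1 - b) * (w + (ln B + ln k)) + a * L + b * (ln B + ln k) +
    (- a * (w + L) - X))).
  by congr (_ * expR _); field.
by rewrite 5!expRD; ring.
Qed.

Lemma capacity_term_meijerG2 (a b B k zeta : R) : admissible_contours a b ->
  0 < B -> 0 < k -> 0 < zeta ->
  mu.-integrable setT (EFin \o capacity_term B k zeta) /\
  (Num.sqrt (k / B))%:C * meijerG2 a b (B * zeta) (B * k) =
  (\int[mu]_w capacity_term B k zeta w)%:C.
Proof.
move=> hab B0 k0 z0; have [im ->] := meijerG2_real (B * zeta) (B * k) hab.
have E w := meijer_integrandE w hab B0 k0 z0.
split; first by rewrite (funext E); exact: integrable_EFinZl.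
by rewrite (funext E) (RintegralZl _ measurableT im) real_complexMr.
Qed.

End meijer_double_integral.

(** * The expected capacity as a real integral *)

Section density.
Context d (T : measurableType d) (R : realType) (P : probability T R).
Variables (X : {RV P >-> R}) (f : R -> R).
Local Notation mu := (@lebesgue_measure R).
Hypothesis f_density : has_density X f.
Hypothesis f_int : mu.-integrable setT (EFin \o f).

(* [X] with values in the Borel space carrying the Lebesgue measure, whose
   display differs from the default one of [R]. *)
Let mX : measurable_fun setT (X : T -> measurableTypeR R).
Proof. exact: (measurable_funPT X). Qed.

Let X' : {mfun T >-> measurableTypeR R} :=
  HB.pack (X : T -> measurableTypeR R) (isMeasurableFun.Build _ _ _ _ _ mX).

Let nu := distribution P X'.

Let nu_mu : nu `<< mu.
Proof.
apply/null_content_dominatesP => A mA muA0; rewrite [LHS](f_density mA).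
apply: null_set_integral => //; apply: measurable_funTS.
exact: (measurable_int _ f_int).
Qed.

Lemma integral_density (h : R -> R) : measurable_fun setT h ->
  (forall x, `|h x| <= 1) ->
  (\int[P]_w (h (X w))%:E = \int[mu]_x (h x * f x)%:E)%E.
Proof.
move=> mh h1.
have mh' : measurable_fun setT (EFin \o h : measurableTypeR R -> \bar R).
  by apply/measurable_EFinP; exact: mh.
have mf : measurable_fun setT (EFin \o f : measurableTypeR R -> \bar R).
  exact: (measurable_int _ f_int).
have ih : nu.-integrable setT (EFin \o h : measurableTypeR R -> \bar R).
  apply: (@le_integrable_EFin _ _ _ nu h (cst 1)) => //.
  exact: finite_measure_integrable_cst.
transitivity (\int[nu]_x (h x)%:E)%E.
  rewrite (@integral_distribution _ _ _ _ _ _ X' (EFin \o h))//.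
  apply: (@le_integrable_EFin _ _ _ P (fun w => h (X w)) (cst 1)) => //.
    by apply: measurableT_comp => //; exact: (measurable_funPT X).
  exact: finite_measure_integrable_cst.
rewrite -(Radon_Nikodym_change_of_variables nu_mu)//=.
have iRN := @Radon_Nikodym_integrable _ _ _ (charge_of_finite_measure nu) mu nu_mu.
apply: ae_eq_integral => //.
- by apply: emeasurable_funM => //; exact: (measurable_int mu).
- by under eq_fun do rewrite EFinM; apply: emeasurable_funM.
- have RNf : ae_eq mu setT (Radon_Nikodym (charge_of_finite_measure nu) mu) (EFin \o f).
    apply: integral_ae_eq => //.
    move=> E _ mE; rewrite -Radon_Nikodym_integral//.
    exact: f_density.
  by apply: filterS RNf => x /= RNx Dx; rewrite RNx.
Qed.

End density.

Section independence.
Context d (T : measurableType d) (R : realType) (P : probability T R).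
Variables (X Y : {RV P >-> R}).
Hypothesis XY : independent_RVs X Y.

(** Independence fixes the joint law on rectangles, and the product measure is the only measure with
    these values. *)
Lemma independent_joint_law (B : set (R * R)) : measurable B ->
  P [set w | B (X w, Y w)] =
  (\int[distribution P X]_x distribution P Y (xsection B x))%E.
Proof.
move=> mB.
pose phi w := (X w, Y w).
have mphi : measurable_fun setT phi by exact: measurable_fun_pair.
have joint A C : measurable A -> measurable C ->
    pushforward P phi (A `*` C) = (distribution P X A * distribution P Y C)%E.
  by move=> mA mC; exact: XY.
have /(_ mphi joint B mB) H := product_measure_unique (m1 := distribution P X)
  (m2 := distribution P Y) (m' := pushforward P phi).
exact: esym H.
Qed.

End independence.

Section logistic.
Context (R : realType).
Local Notation mu := (@lebesgue_measure R).

Definition logistic (s : R) : R := expR s / (1 + expR s).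

Lemma logistic_ge0 s : 0 <= logistic s.
Proof. by rewrite divr_ge0 ?addr_ge0 ?expR_ge0. Qed.

Lemma measurable_logistic : measurable_fun setT logistic.
Proof.
apply: continuous_measurable_fun => s; rewrite /logistic; continuity_rules.
by rewrite gt_eqF// ltr_pwDl ?expR_ge0.
Qed.

Lemma integral_logistic (t : R) : 0 <= t ->
  (\int[mu]_s (logistic s * \1_[set s | expR s < t] s)%:E = (ln (1 + t))%:E)%E.
Proof.
rewrite le_eqVlt => /predU1P[<-|t0].
  rewrite addr0 ln1; apply: integral0_eq => s _; rewrite indicE memNset ?mulr0//=.
  by apply/negP; rewrite -leNgt expR_ge0.
have -> : [set s | expR s < t] = `]-oo, ln t[%classic.
  have E s : (expR s < t) = (s < ln t) by rewrite -{1}[t]lnK ?posrE// ltr_expR.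
  by apply/seteqP; split => s /=; rewrite in_itv/= E.
transitivity (\int[mu]_(s in `]-oo, (ln t)]) (logistic s)%:E)%E.
  rewrite -integral_itv_bndo_bndc; last first.
    by apply/measurable_EFinP/measurable_funTS; exact: measurable_logistic.
  rewrite [RHS]integral_mkcond; apply: eq_integral => s _.
  by rewrite patchE indicE; case: ifPn => _; rewrite ?mulr1 ?mulr0.
pose F s : R := ln (1 + expR s).
apply: (@ge0_integral_FTC _ _ F (fun n => ln t - n%:R) (fun=> ln t)).
- move=> s; rewrite /logistic; continuity_rules.
  by rewrite gt_eqF// ltr_pwDl ?expR_ge0.
- move=> s; have s0 : 0 < 1 + expR s by rewrite ltr_pwDl ?expR_ge0.
  have dl := is_derive1_ln s0.
  by apply: is_derive_eq; rewrite /logistic /GRing.scale /=; field; lra.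
- exact: logistic_ge0.
- by move=> n; rewrite lerBlDr lerDl.
- apply: (@nondecreasing_itvs _ (fun n => ln t - n%:R) (fun=> ln t)) => n m nm //.
  by rewrite lerD2l lerN2 ler_nat.
- apply/seteqP; split => s /=; rewrite in_itv/=.
    move=> st; have [n hn] := natr_archi (ln t - s).
    by exists n => //=; rewrite in_itv/= st andbT; lra.
  by move=> [n _ /=]; rewrite in_itv/= => /andP[].
- rewrite /F lnK ?posrE//.
  have h : (fun n : nat => 1 + t * expR (- (1 * n%:R))) @ \oo --> 1 + t * 0.
    apply: cvgD; first exact: cvg_cst.
    by apply: cvgMl_tmp; exact: cvg_expR_mulrN.
  rewrite mulr0 addr0 in h.
  have c1 : continuous_at (1 : R) (@ln R) by apply: continuous_ln; exact: ltr01.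
  have h2 := cvg_comp _ _ h c1.
  have E n : expR (ln t - n%:R) = t * expR (- (1 * n%:R)).
    by rewrite mul1r expRD lnK ?posrE.
  rewrite -[X in _ --> X]subr0; apply: cvgB; first exact: cvg_cst.
  by rewrite -[X in _ --> X]ln1; under eq_fun do rewrite E.
Qed.

End logistic.

Section measurable_inverse.
Context (R : realType).

(** The only discontinuity is at 0, so the line is split into that point and its open complement. *)
Lemma measurable_invr : measurable_fun setT (fun x : R => x^-1).
Proof.
have m0 : measurable [set (0 : R)] by exact: measurable_set1.
have mC := measurableC m0.
rewrite -(setUv [set (0 : R)]); apply/(measurable_funU _ m0 mC); split.
  exact: measurable_fun_set1.
apply: open_continuous_measurable_fun.
  rewrite (_ : ~` _ = [set x : R | x != 0]); first exact: open_neq.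
  by apply/seteqP; split => x /= /eqP.
by move=> x; rewrite inE => /eqP x0; exact: inv_continuous.
Qed.

End measurable_inverse.

(** * Layer cake formula and tail of the SNDR *)

Section layer_cake.
Context d (T : measurableType d) (R : realType) (P : probability T R).
Variables (X Y : {RV P >-> R}) (zeta c : R) (f Fbar : R -> R).
Local Notation mu := (@lebesgue_measure R).
Hypotheses (zeta0 : 0 < zeta) (c0 : 0 < c).
Hypothesis XY : independent_RVs X Y.
Hypotheses (X0 : {ae P, forall w, 0 <= X w}) (Y0 : {ae P, forall w, 0 <= Y w}).
Hypothesis f_density : has_density X f.
Hypothesis f_int : mu.-integrable setT (EFin \o f).
Hypothesis FbarE : forall t, 0 <= t -> cdf Y t = (1 - Fbar t)%:E.

Let mX : measurable_fun setT (X : T -> R). Proof. exact: (measurable_funPT X). Qed.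
Let mY : measurable_fun setT (Y : T -> R). Proof. exact: (measurable_funPT Y). Qed.

(** The event g > e^s with its denominator cleared. The condition on the second coordinate is built
    in because Y is nonnegative only almost surely. *)
Definition sndr_level (s : R) : set (R * R) :=
  [set z | (expR s * (zeta * z.2 + c) < z.1 * z.2) && (0 <= z.2)].

Let sndr (w : T) : R := X w * Y w / (zeta * Y w + c).

Let M : set (T * R) :=
  [set z | (expR z.2 * (zeta * Y z.1 + c) < X z.1 * Y z.1) && (0 <= Y z.1)].

Lemma measurable_ltle d' (S : measurableType d') (f1 f2 f3 : S -> R) :
  measurable_fun setT f1 -> measurable_fun setT f2 -> measurable_fun setT f3 ->
  measurable [set z | (f1 z < f2 z) && (0 <= f3 z)].
Proof.
move=> m1 m2 m3.
have h : measurable_fun setT (fun z => (f1 z < f2 z) && (0 <= f3 z)).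
  apply: measurable_and; first exact: measurable_fun_ltr.
  exact: measurable_fun_ler.
by have := h measurableT [set true] I; rewrite setTI.
Qed.

Lemma measurable_sndr_level s : measurable (sndr_level s).
Proof. by apply: measurable_ltle; measurability_rules. Qed.

Let mM : measurable M.
Proof.
have m1 : measurable_fun setT (fun z : T * R => X z.1).
  exact: (measurableT_comp mX measurable_fst).
have m2 : measurable_fun setT (fun z : T * R => Y z.1).
  exact: (measurableT_comp mY measurable_fst).
by apply: measurable_ltle; measurability_rules.
Qed.

Let k (z : T * R) : \bar R := (logistic z.2 * \1_M z)%:E.

Let mk : measurable_fun setT k.
Proof.
apply/measurable_EFinP; apply: measurable_funM; last exact: measurable_indic.
exact: (measurableT_comp (@measurable_logistic R) measurable_snd).
Qed.

Let mk' : measurable_fun setT (k : T * measurableTypeR R -> \bar R).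
Proof. exact: mk. Qed.

Let k0 z : (0 <= k z)%E.
Proof. by rewrite lee_fin mulr_ge0 ?logistic_ge0. Qed.

Let ln_layer_cake w : 0 <= X w -> 0 <= Y w ->
  (\int[mu]_s k (w, s) = (ln (1 + sndr w))%:E)%E.
Proof.
move=> x0 y0.
have D0 : 0 < zeta * Y w + c by rewrite ltr_wpDl// mulr_ge0// ltW.
rewrite -integral_logistic; last by rewrite divr_ge0 ?mulr_ge0// ltW.
apply: eq_integral => s _; rewrite /k /=; congr (_ * _)%:E.
rewrite !indicE; congr (nat_of_bool _)%:R; apply/idP/idP; rewrite !inE /M /=.
  by rewrite y0 andbT /sndr ltr_pdivlMr.
by rewrite y0 andbT /sndr ltr_pdivlMr.
Qed.

Lemma measurable_ln_sndr : measurable_fun setT (fun w => ln (1 + sndr w)).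
Proof.
apply: (measurableT_comp (@measurable_ln R)).
apply: measurable_funD => //; apply: measurable_funM; first exact: measurable_funM.
by apply: (measurableT_comp (@measurable_invr R)); measurability_rules.
Qed.

(** Tonelli exchanges the expectation with the layer-cake integral. The constant r, later 1 / ln 2,
    is carried along so that the logarithm to base 2 needs no separate treatment. *)
Lemma integral_ln_sndr (r : R) : 0 <= r ->
  (\int[P]_w (r * ln (1 + sndr w))%:E =
   r%:E * \int[mu]_s ((logistic s)%:E * P [set w | sndr_level s (X w, Y w)]))%E.
Proof.
move=> r0.
have mF := @measurable_fun_fubini_tonelli_F _ _ T (measurableTypeR R) R mu k mk' k0.
have F0 w : [set: T] w -> (0 <= fubini_F mu k w)%E by move=> _; exact: integral_ge0.
transitivity (r%:E * \int[P]_w \int[mu]_s k (w, s))%E.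
  have <- := ge0_integralZl P measurableT mF F0 (r0 : (0 <= r%:E)%E).
  apply: ae_eq_integral => //.
  - apply/measurable_EFinP; apply: measurable_funM => //; exact: measurable_ln_sndr.
  - exact: measurable_funeM.
  - by apply: filterS2 X0 Y0 => w x0 y0 _; rewrite /fubini_F ln_layer_cake.
congr (_ * _)%E.
rewrite (@fubini_tonelli _ _ T (measurableTypeR R) R P mu k mk' k0); apply: eq_integral => s _.
rewrite /k /=.
under eq_integral do rewrite EFinM.
have E w : \1_M (w, s) = \1_[set w | sndr_level s (X w, Y w)] w :> R by [].
have mA : measurable [set w | sndr_level s (X w, Y w)].
  by apply: measurable_ltle; measurability_rules.
have mI : measurable_fun setT (EFin \o (\1_[set w | sndr_level s (X w, Y w)] : T -> R)).
  by apply/measurable_EFinP; exact: measurable_indic mA.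
transitivity ((logistic s)%:E *
    \int[P]_w (EFin \o (\1_[set w | sndr_level s (X w, Y w)] : T -> R)) w)%E.
  have l0 : (0 <= (logistic s)%:E)%E by rewrite lee_fin logistic_ge0.
  have I0 w : [set: T] w ->
      (0 <= (EFin \o (\1_[set w | sndr_level s (X w, Y w)] : T -> R)) w)%E.
    by move=> _; rewrite lee_fin.
  have <- := ge0_integralZl P measurableT mI I0 l0.
  by apply: eq_integral => w _; rewrite /= E.
by congr (_ * _)%E; rewrite (integral_indic _ _ mA)// setIT.
Qed.

Lemma survivalE t : 0 <= t -> distribution P Y `]t, +oo[ = (Fbar t)%:E.
Proof.
move=> t0; have := FbarE t0; rewrite /cdf => h.
rewrite -setCitvl probability_setC// [X in (_ - X)%E]h -EFinB; congr EFin; ring.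
Qed.

(** The SNDR never exceeds x / zeta for y >= 0, so the section is empty when x <= zeta e^s;
    otherwise solving the inequality for y gives a half-line of nonnegative numbers. *)
Let level_section s x : distribution P Y (xsection (sndr_level s) x) =
  (if zeta * expR s < x then Fbar (c * expR s / (x - zeta * expR s)) else 0)%:E.
Proof.
have e0 := expR_gt0 s; case: ifPn => [xs|]; last first.
  rewrite -leNgt => xs; have -> : xsection (sndr_level s) x = set0; last by rewrite measure0.
  apply/seteqP; split => y //; rewrite /xsection/= inE /sndr_level/= => /andP[h y0].
  have := ler_wpM2r y0 xs; have := mulr_gt0 e0 c0; nra.
have D0 : 0 < x - zeta * expR s by rewrite subr_gt0.
rewrite -survivalE; last by rewrite divr_ge0 ?mulr_ge0// ltW.
congr (distribution P Y _); apply/seteqP; split => y;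
  rewrite /xsection/= inE /sndr_level/= in_itv/= andbT ltr_pdivrMr//.
  by move=> /andP[h y0]; nra.
move=> h; have y0 : 0 < y.
  by rewrite -(pmulr_lgt0 _ D0) (lt_trans _ h)// mulr_gt0.
by rewrite (ltW y0) andbT; nra.
Qed.

Lemma level_probability s :
  P [set w | sndr_level s (X w, Y w)] =
  (\int[mu]_(v in `]0, +oo[) (Fbar (c * expR s / v) * f (v + zeta * expR s)))%:E.
Proof.
pose h x := if zeta * expR s < x then Fbar (c * expR s / (x - zeta * expR s)) else 0.
have mB := measurable_sndr_level s.
have hE x : distribution P Y (xsection (sndr_level s) x) = (h x)%:E.
  exact: level_section.
(* Measurability of h, and its bounds 0 and 1, are inherited from the probability of a section
   rather than from a formula for [Fbar]. *)
have mh : measurable_fun setT h.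
  apply/measurable_EFinP.
  have := measurable_fun_xsection (distribution P Y) mB.
  by congr measurable_fun; apply/funext => x; exact: hE.
have h0 x : 0 <= h x by rewrite -lee_fin -hE.
have h1 x : `|h x| <= 1.
  rewrite ger0_norm// -lee_fin -hE; apply: probability_le1.
  exact: measurable_xsection.
rewrite (independent_joint_law XY mB); under eq_integral do rewrite hE.
have mhE : measurable_fun setT (EFin \o h) by exact/measurable_EFinP.
have h0E x : (0 <= (EFin \o h) x)%E by rewrite lee_fin.
rewrite (ge0_integral_distribution X mhE h0E).
rewrite [LHS](integral_density f_density f_int mh h1).
have ihf : mu.-integrable setT (EFin \o (fun x => h x * f x)).
  apply: (le_integrable_EFin _ _ (integrable_norm f_int)).
    apply: measurable_funM => //.
    by apply/measurable_EFinP; exact: (measurable_int _ f_int).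
  by move=> x; rewrite normrM ler_piMl.
rewrite -[LHS]fineK; last exact: (integrable_fin_num measurableT ihf).
congr EFin; rewrite -/(Rintegral mu setT (fun x => h x * f x)).
have one0 : 1 != 0 :> R by [].
have [_ ->] := Rintegral_affine (zeta * expR s) one0 ihf.
rewrite normr1 mul1r [RHS]Rintegral_mkcond; apply: eq_Rintegral => v _.
rewrite patchE mul1r; case: ifPn => [|].
  rewrite inE/= in_itv/= andbT => v0.
  by rewrite /h ltrDr v0 addrK.
move/negP; rewrite inE/= in_itv/= andbT => /negP; rewrite -leNgt => v0.
by rewrite /h ltrDr ltNge v0 mul0r.
Qed.

End layer_cake.

Section finite_sums.
Context d (T : measurableType d) (R : realType) (mu : {measure set T -> \bar R}).

Lemma Rintegral_sum (D : set T) (I : Type) (s : seq I) (F : I -> T -> R) :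
  measurable D -> (forall i, mu.-integrable D (EFin \o F i)) ->
  mu.-integrable D (EFin \o (fun x => \sum_(i <- s) F i x)) /\
  \int[mu]_(x in D) (\sum_(i <- s) F i x) = \sum_(i <- s) \int[mu]_(x in D) F i x.
Proof.
move=> mD iF.
have isum t : mu.-integrable D (EFin \o (fun x => \sum_(i <- t) F i x)).
  have -> : EFin \o (fun x => \sum_(i <- t) F i x) = (fun x => \sum_(i <- t) (F i x)%:E)%E.
    by apply/funext => x /=; rewrite sumEFin.
  by apply: (integrable_sum mD) => i _; exact: iF.
split; first exact: isum.
elim: s => [|i s IH].
  by under eq_Rintegral do rewrite big_nil; rewrite big_nil /Rintegral integral0.
under eq_Rintegral do rewrite big_cons.
by rewrite big_cons (RintegralD mD (iF i) (isum s)) IH.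
Qed.

Lemma integrableZl_on (D : set T) (f : T -> R) (r : R) : measurable D ->
  mu.-integrable D (EFin \o f) -> mu.-integrable D (EFin \o (fun x => r * f x)).
Proof. by move=> mD; exact: (integrableZl mD r). Qed.

Lemma Rintegral_sum4 (D : set T) (s1 s2 s3 s4 : seq nat)
    (a : nat -> nat -> nat -> nat -> R) (F : nat -> nat -> nat -> nat -> T -> R) :
  measurable D -> (forall m n i j, mu.-integrable D (EFin \o F m n i j)) ->
  mu.-integrable D (EFin \o (fun x =>
    \sum_(m <- s1) \sum_(n <- s2) \sum_(i <- s3) \sum_(j <- s4) a m n i j * F m n i j x)) /\
  \int[mu]_(x in D)
    (\sum_(m <- s1) \sum_(n <- s2) \sum_(i <- s3) \sum_(j <- s4) a m n i j * F m n i j x) =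
  \sum_(m <- s1) \sum_(n <- s2) \sum_(i <- s3) \sum_(j <- s4)
    a m n i j * \int[mu]_(x in D) F m n i j x.
Proof.
move=> mD iF.
have i4 m n i := Rintegral_sum s4 mD (fun j => integrableZl_on (a m n i j) mD (iF m n i j)).
have i3 m n := Rintegral_sum s3 mD (fun i => (i4 m n i).1).
have i2 m := Rintegral_sum s2 mD (fun n => (i3 m n).1).
have i1 := Rintegral_sum s1 mD (fun m => (i2 m).1).
split; first exact: i1.1.
rewrite i1.2; apply: eq_bigr => m _; rewrite (i2 m).2; apply: eq_bigr => n _.
rewrite (i3 m n).2; apply: eq_bigr => i _; rewrite (i4 m n i).2; apply: eq_bigr => j _.
by rewrite RintegralZl.
Qed.

End finite_sums.

(** * The relay distributions as exponential sums *)

Section relay_model.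
Context (R : realType).
Local Notation mu := (@lebesgue_measure R).
Variables (N k : nat) (g1 g2 rho1 rho2 : R).
Hypotheses (hg1 : 0 < g1) (hg2 : 0 < g2).
Hypotheses (hrho1 : 0 <= rho1 <= 1) (hrho2 : 0 <= rho2 <= 1).

Lemma snr_bar_gt0 : 0 < snr_bar g1 g2.
Proof. by rewrite /snr_bar divr_gt0 ?mulr_gt0 ?addr_gt0. Qed.

Lemma mixture_gt0 (rho g : R) (n : nat) : 0 <= rho <= 1 -> 0 < g ->
  0 < rho * snr_bar g1 g2 + (1 - rho) * (n + 1)%:R * g.
Proof.
move=> /andP[r0 r1] g0; have s0 := snr_bar_gt0.
have n0 : 0 < (n + 1)%:R * g by rewrite mulr_gt0// ltr0n addn1.
rewrite -mulrA; have [r_gt0|r_le0] := ltP 0 rho.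
  apply: ltr_pwDl; first exact: mulr_gt0.
  by apply: mulr_ge0; [rewrite subr_ge0|exact: ltW].
have -> : rho = 0 by apply/eqP; rewrite eq_le r_le0.
by rewrite mul0r add0r subr0 mul1r.
Qed.

Lemma coefR_gt0 n j : 0 < coefR N k g1 g2 rho1 n j.
Proof.
rewrite /coefR; case: ifP => // _.
by rewrite divr_gt0 ?mixture_gt0// mulr_gt0// ltr0n addn1.
Qed.

Lemma coefU_gt0 m i : 0 < coefU N k g1 g2 rho2 m i.
Proof.
rewrite /coefU; case: ifP => _; first exact: divr_gt0.
by rewrite divr_gt0 ?mixture_gt0// mulr_gt0// ltr0n addn1.
Qed.

(** On the half-line x >= 0 the exponentials agree with [laplace], so the density is the restriction
    of an integrable finite sum. *)
Lemma first_hop_pdf_integrable :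
  mu.-integrable setT (EFin \o first_hop_pdf N k g1 g2 rho1).
Proof.
pose F n j x := coefP N k g1 g2 n * coefQ N k g1 g2 rho1 n j *
  laplace (coefR N k g1 g2 rho1 n j / g1) x.
have iF n j : mu.-integrable setT (EFin \o F n j).
  apply: integrable_EFinZl; apply: integrable_laplace.
  by rewrite divr_gt0 ?coefR_gt0.
have i1 n := (Rintegral_sum (index_iota 1 3) measurableT (iF n)).1.
have i2 := (Rintegral_sum (index_iota 0 k) measurableT i1).1.
have i3 := integrable_norm (integrable_EFinZl (k%:R / g1 * 'C(N, k)%:R) i2).
have E : first_hop_pdf N k g1 g2 rho1 = (fun x => (k%:R / g1 * 'C(N, k)%:R *
    \sum_(0 <= n < k) \sum_(1 <= j < 3) F n j x) * \1_`[0, +oo[%classic x).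
  apply/funext => x; rewrite /first_hop_pdf indicE mem_setE in_itv/= andbT.
  case: ifPn => x0; rewrite ?mulr0// mulr1; congr (_ * _).
  apply: eq_bigr => n _; apply: eq_bigr => j _; congr (_ * expR (- _)).
  by rewrite ger0_norm// mulrAC.
rewrite E; apply: (le_integrable_EFin _ _ i3).
  apply: measurable_funM; last exact: measurable_indic.
  by apply/measurable_EFinP; exact: (measurable_int _ (integrable_EFinZl (k%:R / g1 * 'C(N, k)%:R) i2)).
move=> x; rewrite normrM ler_piMr// indicE; case: (_ \in _); by rewrite ?normr1 ?normr0.
Qed.

Definition second_hop_tail (x : R) : R := k%:R * 'C(N, k)%:R *
  \sum_(0 <= m < k) \sum_(1 <= i < 3)
    coefS N k g1 g2 m * coefT N k g1 g2 m i * expR (- (coefU N k g1 g2 rho2 m i * x / g1)).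

Variables (c zeta : R).
Hypotheses (c0 : 0 < c) (zeta0 : 0 < zeta).

(** With B = [rate] and K = [scale], the quantities B zeta, B K and K / B are the two arguments of
    the Meijer function and the number under the square root. *)
Definition rate n j := coefR N k g1 g2 rho1 n j / g1.
Definition scale m i := coefU N k g1 g2 rho2 m i * c / g1.
Definition weight m n i j := coefS N k g1 g2 m * coefP N k g1 g2 n
  * coefT N k g1 g2 m i * coefQ N k g1 g2 rho1 n j.

Lemma rate_gt0 n j : 0 < rate n j.
Proof. by rewrite divr_gt0 ?coefR_gt0. Qed.

Lemma scale_gt0 m i : 0 < scale m i.
Proof. by rewrite divr_gt0 ?mulr_gt0 ?coefU_gt0. Qed.

Lemma hop_product_expansion (s v : R) : 0 < v ->
  second_hop_tail (c * expR s / v) * first_hop_pdf N k g1 g2 rho1 (v + zeta * expR s) =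
  k%:R ^+ 2 * 'C(N, k)%:R ^+ 2 / g1 *
  \sum_(0 <= m < k) \sum_(0 <= n < k) \sum_(1 <= i < 3) \sum_(1 <= j < 3)
    weight m n i j * (expR (- (rate n j * (zeta * expR s))) *
      hop_integrand (rate n j) (scale m i * expR s) v).
Proof.
move=> v0; rewrite /first_hop_pdf addr_ge0 ?mulr_ge0 ?expR_ge0 ?(ltW v0) ?(ltW zeta0)//.
rewrite /second_hop_tail.
set A := \sum_(0 <= m < k) _; set B := \sum_(0 <= n < k) _; set C := \sum_(0 <= m < k) _.
have -> : C = A * B; last by field; rewrite gt_eqF.
rewrite /A big_distrl/=; apply: eq_bigr => m _.
rewrite /B big_distrr/=; apply: eq_bigr => n _.
rewrite big_distrl/=; apply: eq_bigr => i _.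
rewrite big_distrr/=; apply: eq_bigr => j _.
have -> : expR (- (coefR N k g1 g2 rho1 n j * (v + zeta * expR s) / g1)) =
    expR (- (rate n j * (zeta * expR s))) * expR (- (rate n j * v)).
  by rewrite -expRD; congr expR; rewrite /rate; field; rewrite gt_eqF.
have -> : coefU N k g1 g2 rho2 m i * (c * expR s / v) / g1 = scale m i * expR s / v.
  by rewrite /scale; field; rewrite !gt_eqF.
by rewrite /weight /hop_integrand; ring.
Qed.

Lemma logistic_level_expansion (s : R) :
  logistic s * \int[mu]_(v in `]0, +oo[)
    (second_hop_tail (c * expR s / v) * first_hop_pdf N k g1 g2 rho1 (v + zeta * expR s)) =
  k%:R ^+ 2 * 'C(N, k)%:R ^+ 2 / g1 *
  \sum_(0 <= m < k) \sum_(0 <= n < k) \sum_(1 <= i < 3) \sum_(1 <= j < 3)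
    weight m n i j * capacity_term (rate n j) (scale m i) zeta s.
Proof.
pose F m n i j v := expR (- (rate n j * (zeta * expR s))) *
      hop_integrand (rate n j) (scale m i * expR s) v.
have m0 : measurable (`]0, +oo[%classic : set (measurableTypeR R)) by exact: measurable_itv.
have iF (m n i j : nat) : mu.-integrable `]0, +oo[ (EFin \o F m n i j).
  apply: integrableZl_on => //; apply: integrable_hop; first exact: rate_gt0.
  by rewrite mulr_gt0 ?scale_gt0 ?expR_gt0.
have [i4 E4] := Rintegral_sum4 (index_iota 0 k) (index_iota 0 k) (index_iota 1 3)
  (index_iota 1 3) weight m0 iF.
transitivity (logistic s * (k%:R ^+ 2 * 'C(N, k)%:R ^+ 2 / g1 *
  \sum_(0 <= m < k) \sum_(0 <= n < k) \sum_(1 <= i < 3) \sum_(1 <= j < 3)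
    weight m n i j * \int[mu]_(v in `]0, +oo[) F m n i j v)).
  rewrite -E4 -(RintegralZl _ m0 i4); congr (_ * _); apply: eq_Rintegral => v.
  by rewrite inE/= in_itv/= andbT => v0; exact: hop_product_expansion.
rewrite mulrCA; congr (_ * _); rewrite big_distrr/=; apply: eq_bigr => m _.
rewrite big_distrr/=; apply: eq_bigr => n _; rewrite big_distrr/=; apply: eq_bigr => i _.
by rewrite big_distrr/=; apply: eq_bigr => j _; rewrite mulrCA.
Qed.

End relay_model.

Section mean.
Context d (T : measurableType d) (R : realType) (P : probability T R).

(** X is replaced by |X| almost everywhere; should the mean be infinite, [fine] returns 0, which
    also satisfies the bound. *)
Lemma mean_ge0 (X : {RV P >-> R}) : {ae P, forall w, 0 <= X w} -> 0 <= mean X.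
Proof.
move=> X0; have mX : measurable_fun setT (X : T -> R) by exact: (measurable_funPT X).
rewrite /mean unlock.
have -> : (\int[P]_w (X w)%:E = \int[P]_w (`|X w|)%:E)%E.
  apply: ae_eq_integral => //.
  - exact/measurable_EFinP.
  - by apply/measurable_EFinP; exact: measurableT_comp.
  - by apply: filterS X0 => w x0 _; rewrite ger0_norm.
by apply: fine_ge0; apply: integral_ge0 => w _; rewrite lee_fin.
Qed.

End mean.

Theorem mainTheorem7 (R : realType) (d : measure_display)
    (T : measurableType d) (P : probability T R)
    (N k : nat) (g1 g2 rho1 rho2 zeta : R) (X Y : {RV P >-> R})
    (hk : (1 <= k <= N)%N)
    (hg1 : 0 < g1) (hg2 : 0 < g2)
    (hrho1 : 0 <= rho1 <= 1) (hrho2 : 0 <= rho2 <= 1)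
    (hzeta : 1 <= zeta)
    (hXY : independent_RVs X Y)
    (hX0 : {ae P, forall w, 0 <= X w}) (hY0 : {ae P, forall w, 0 <= Y w})
    (hX : has_density X (first_hop_pdf N k g1 g2 rho1))
    (hY : forall x : R, 0 <= x -> cdf Y x = (second_hop_cdf N k g1 g2 rho2 x)%:E)
    (a b : R) (hab : admissible_contours a b) :
  let c := mean X + zeta in
  exists C : R,
    ergodic_capacity X Y zeta = C%:E /\
    C%:C =
      (k%:R ^+ 2 * 'C(N, k)%:R ^+ 2 / (2 * ln 2 * g1))%:C *
      \sum_(0 <= m < k) \sum_(0 <= n < k) \sum_(1 <= i < 3) \sum_(1 <= j < 3)
        (coefS N k g1 g2 m * coefP N k g1 g2 n
         * coefT N k g1 g2 m i * coefQ N k g1 g2 rho1 n j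
         * Num.sqrt (coefU N k g1 g2 rho2 m i * c
                     / coefR N k g1 g2 rho1 n j))%:C
        * meijerG2 a b
            (coefR N k g1 g2 rho1 n j * zeta / g1)
            (coefU N k g1 g2 rho2 m i * coefR N k g1 g2 rho1 n j * c
             / g1 ^+ 2).
Proof.
move=> c.
have z0 : 0 < zeta by lra.
have c0 : 0 < c by have := mean_ge0 hX0; rewrite /c; lra.
have ln20 : 0 < ln 2 :> R by rewrite ln_gt0// ltr1n.
pose mu := @lebesgue_measure R.
pose B n j := rate N k g1 g2 rho1 n j.
pose K m i := scale N k g1 g2 rho2 c m i.
have B0 n j : 0 < B n j by exact: rate_gt0.
have K0 m i : 0 < K m i by exact: scale_gt0.
pose w m n i j := weight N k g1 g2 rho1 m n i j.
(* The common real value: the expectation side and the Mellin-Barnes side are both reduced to S, up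
   to the same constant. *)
pose S := \sum_(0 <= m < k) \sum_(0 <= n < k) \sum_(1 <= i < 3) \sum_(1 <= j < 3)
  w m n i j * \int[mu]_s capacity_term (B n j) (K m i) zeta s.
exists (k%:R ^+ 2 * 'C(N, k)%:R ^+ 2 / (2 * ln 2 * g1) * S); split.
- rewrite /ergodic_capacity unlock.
  have -> : (fun v => (log2 (1 + fixed_gain_sndr X Y zeta v))%:E) =
      (fun v => ((ln 2)^-1 * ln (1 + X v * Y v / (zeta * Y v + c)))%:E).
    by apply/funext => v; rewrite /log2 /fixed_gain_sndr -addrA mulrC.
  have i20 : 0 <= (ln 2)^-1 :> R by rewrite invr_ge0 ltW.
  rewrite (integral_ln_sndr z0 c0 hX0 hY0 i20).
  have hF t : 0 <= t -> cdf Y t = (1 - second_hop_tail N k g1 g2 rho2 t)%:E by exact: hY.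
  have fi := @first_hop_pdf_integrable R N k g1 g2 rho1 hg1 hg2 hrho1.
  (* The Mellin-Barnes side supplies this integrability, which makes the extended integral finite
     and allows it to be distributed over the signed sum. *)
  have iC (m n i j : nat) : mu.-integrable setT (EFin \o capacity_term (B n j) (K m i) zeta).
    exact: (capacity_term_meijerG2 hab (B0 n j) (K0 m i) z0).1.
  have [i4 E4] := Rintegral_sum4 (index_iota 0 k) (index_iota 0 k) (index_iota 1 3)
    (index_iota 1 3) w measurableT iC.
  have -> : (\int[mu]_s ((logistic s)%:E * P [set v | sndr_level zeta c s (X v, Y v)]) =
      (k%:R ^+ 2 * 'C(N, k)%:R ^+ 2 / g1 * S)%:E)%E.
    rewrite /S -E4 -(RintegralZl _ measurableT i4).
    rewrite /Rintegral fineK; last first.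
      exact: (integrable_fin_num measurableT (integrable_EFinZl _ i4)).
    apply: eq_integral => s _; rewrite (level_probability zeta c0 hXY hX fi hF) -EFinM.
    by rewrite (logistic_level_expansion N k hg1 hg2 hrho1 hrho2 c0 z0).
  rewrite -!EFinM; congr EFin; field.
  by rewrite !gt_eqF.
rewrite -real_complexMr; congr (_ * _).
rewrite /S !rmorph_sum; apply: eq_bigr => m _.
rewrite !rmorph_sum; apply: eq_bigr => n _.
rewrite !rmorph_sum; apply: eq_bigr => i _.
rewrite !rmorph_sum; apply: eq_bigr => j _.
transitivity ((w m n i j)%:C * (\int[mu]_s capacity_term (B n j) (K m i) zeta s)%:C).
  by rewrite real_complexMr.
have [_ <-] := capacity_term_meijerG2 hab (B0 n j) (K0 m i) z0.
have R0 : 0 < coefR N k g1 g2 rho1 n j by exact: coefR_gt0.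
have -> : B n j * zeta = coefR N k g1 g2 rho1 n j * zeta / g1.
  by rewrite /B /rate mulrAC.
have -> : B n j * K m i = coefU N k g1 g2 rho2 m i * coefR N k g1 g2 rho1 n j * c / g1 ^+ 2.
  by rewrite /B /K /rate /scale; field; rewrite gt_eqF.
have -> : K m i / B n j = coefU N k g1 g2 rho2 m i * c / coefR N k g1 g2 rho1 n j.
  by rewrite /B /K /rate /scale; field; rewrite !gt_eqF.
by rewrite mulrA real_complexMr.
Qed.
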